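(* For every $n\ge1$, the number of configurations of the twenty-vertex model with DWBC1 on the $n\times n$ grid, and likewise the number with DWBC2, is equal to $T_4(\mathcal A_n)$.
   Context: Twenty-vertex model: vertices $(x,y)\in\{1,\dots,n\}^2$; inner edges horizontal $\{(x,y),(x+1,y)\}$ ($x<n$), vertical $\{(x,y),(x,y+1)\}$ ($y<n$), diagonal $\{(x,y+1),(x+1,y)\}$ ($x,y<n$); boundary edges oriented from $(0,y)$ to $(1,y)$ and from $(n+1,y)$ to $(n,y)$ ($1\le y\le n$), from $(0,y+1)$ to $(1,y)$ and from $(n+1,y)$ to $(n,y+1)$ ($1\le y\le n-1$), from $(x,1)$ to $(x,0)$ and from $(x,n)$ to $(x,n+1)$ ($1\le x\le n$), from $(x,1)$ to $(x+1,0)$ and from $(x+1,n)$ to $(x,n+1)$ ($1\le x\le n-1$); corner edges oriented from $(0,n+1)$ to $(1,n)$ and from $(n,1)$ to $(n+1,0)$ for DWBC1, and from $(1,n)$ to $(0,n+1)$ and from $(n+1,0)$ to $(n,1)$ for DWBC2. A configuration is an orientation of the inner edges such that every vertex has exactly three incoming and three outgoing incident edges. $T_4(\mathcal A_n)$ is the number of quarter-turn symmetric domino tilings of the $2n\times2n$ Aztec-like quasi-square with a central cross-shaped hole; equivalently, it is the number of pairs $(I,\mathcal P)$ where $I=\{i_1<\dots<i_\ell\}\subseteq\{0,\dots,n-1\}$ (possibly empty) and $\mathcal P$ is a family of pairwise vertex-disjoint lattice paths with steps $(-1,0),(0,1),(-1,1)$, none ending with a $(0,1)$ step, the $k$-th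 going from $(i_k,0)$ to $(0,i_k+1)$. *)

(* Defs.v *)
From mathcomp Require Import all_boot all_order all_algebra zify.
Set Implicit Arguments.
Unset Strict Implicit.
Unset Printing Implicit Defensive.
Import Order.TTheory GRing.Theory Num.Theory.

(** * The twenty-vertex model with domain wall boundary conditions *)

Definition site : Type := (nat * nat)%type.

(** An ordered pair [(u, v)], standing for an edge oriented from [u] to [v]. *)
Definition arc : Type := (site * site)%type.

Definition grid (n : nat) : seq site :=
  [seq (x, y) | x <- iota 1 n, y <- iota 1 n].

(** Each inner edge is listed once, as the pair of its end points in an
    arbitrary reference order; [iota 1 n.-1] is the range [1, ..., n-1]. *)
Definition inner_edges (n : nat) : seq arc :=
  [seq ((x, y), (x.+1, y)) | x <- iota 1 n.-1, y <- iota 1 n] ++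
  [seq ((x, y), (x, y.+1)) | x <- iota 1 n, y <- iota 1 n.-1] ++
  [seq ((x, y.+1), (x.+1, y)) | x <- iota 1 n.-1, y <- iota 1 n.-1].

Variant dwbc := DWBC1 | DWBC2.

Definition corner_arcs (n : nat) (b : dwbc) : seq arc :=
  match b with
  | DWBC1 => [:: ((0, n.+1), (1, n)); ((n, 1), (n.+1, 0))]
  | DWBC2 => [:: ((1, n), (0, n.+1)); ((n.+1, 0), (n, 1))]
  end.

Definition boundary_arcs (n : nat) (b : dwbc) : seq arc :=
  [seq ((0, y), (1, y)) | y <- iota 1 n] ++
  [seq ((n.+1, y), (n, y)) | y <- iota 1 n] ++
  [seq ((0, y.+1), (1, y)) | y <- iota 1 n.-1] ++
  [seq ((n.+1, y), (n, y.+1)) | y <- iota 1 n.-1] ++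
  [seq ((x, 1), (x, 0)) | x <- iota 1 n] ++
  [seq ((x, n), (x, n.+1)) | x <- iota 1 n] ++
  [seq ((x, 1), (x.+1, 0)) | x <- iota 1 n.-1] ++
  [seq ((x.+1, n), (x, n.+1)) | x <- iota 1 n.-1] ++
  corner_arcs n b.

Definition inner_edge (n : nat) := seq_sub (inner_edges n).

(** An orientation keeps ([true]) or reverses ([false]) the reference order of
    every inner edge. *)
Definition orientation (n : nat) := {ffun inner_edge n -> bool}.

Definition inner_arcs (n : nat) (o : orientation n) : seq arc :=
  [seq if o e then val e else ((val e).2, (val e).1) | e <- enum {: inner_edge n}].

Definition arcs (n : nat) (b : dwbc) (o : orientation n) : seq arc :=
  boundary_arcs n b ++ inner_arcs o.

Definition ice_rule (n : nat) (b : dwbc) (o : orientation n) : bool :=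
  all (fun v : site =>
         (count (fun a : arc => a.2 == v) (arcs b o) == 3) &&
         (count (fun a : arc => a.1 == v) (arcs b o) == 3))
      (grid n).

Definition num_20V (n : nat) (b : dwbc) : nat :=
  #|[set o : orientation n | ice_rule b o]|.

(** * The number [T4 n] *)

Local Open Scope ring_scope.

Definition point : Type := (int * int)%type.

Definition lstep := seq_sub [:: (-1, 0) : point; (0, 1) : point; (-1, 1) : point].

Definition path_vertices (a : point) (s : seq lstep) : seq point :=
  a :: scanl (fun p (st : lstep) => p + val st) a s.

Definition start (i : nat) : point := (i%:Z, 0).

(** The sequence of steps [s] is a path from [(i, 0)] to [(0, i + 1)] whose last
    step is not [(0, 1)]. *)
Definition admissible (i : nat) (s : seq lstep) : bool :=
  (last (start i) (path_vertices (start i) s) == (0, (i.+1)%:Z)) &&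
  (last 0 (map val s) != (0, 1)).

(** The bounded length loses nothing for starting points [(i, 0)] with [i < n];
    it only makes the type finite. *)
Lemma admissible_size (i : nat) (s : seq lstep) :
  admissible i s -> (size s <= i.*2.+1)%N.
Proof.
pose h (p : point) : int := p.2 - p.1.
have h_step p (st : lstep) : h p + 1 <= h (p + val st).
  by case: p st => [x y] [v /=]; rewrite !inE => /or3P[] /eqP->; rewrite /h /=; lia.
have h_last t a : h a + (size t)%:Z <= h (last a (path_vertices a t)).
  elim: t a => [|st t IHt] a /=; first by rewrite addr0.
  by have := IHt (a + val st); have := h_step a st; rewrite /=; lia.
case/andP=> /eqP s_end _; have := h_last s (start i).
rewrite s_end /h /=; lia.
Qed.

Definition lpath (n : nat) := {bseq n.*2 of lstep}.

Definition disjoint_family (n : nat) (I : {set 'I_n})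
    (P : {ffun {i : 'I_n | i \in I} -> lpath n}) : bool :=
  [forall i : {i : 'I_n | i \in I}, admissible (val i) (P i)] &&
  [forall i : {i : 'I_n | i \in I}, forall j : {i : 'I_n | i \in I},
     (i != j) ==> ~~ has (mem (path_vertices (start (val i)) (P i)))
                         (path_vertices (start (val j)) (P j))].

(** Quarter-turn symmetric domino tilings of the [2n x 2n] Aztec-like
    quasi-square with a central cross-shaped hole, counted through their
    encoding as pairs of a set [I] and a family of non-intersecting paths. *)
Definition T4 (n : nat) : nat :=
  (\sum_(I : {set 'I_n}) #|[set P | disjoint_family (I := I) P]|)%N.

(* Main.v *)
(** A configuration of the twenty-vertex model is a family of particles moving
    along horizontal, vertical and diagonal lines, so that the number of
    configurations is a matrix element of an ordered product of three-line vertex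
    operators. Each of these factors into six-vertex operators, and the
    Yang-Baxter equation slides every diagonal line out of the grid, past which it
    acts trivially on the boundary states. What remains is the six-vertex
    partition function with domain wall boundary conditions and weights
    [a = 1], [b = sqrt 2], [c = 1], for DWBC1 and DWBC2 alike.

    The Izergin-Korepin formula evaluates its inhomogeneous version as a
    determinant of entries [1 / ((1 - u - v - u v) (1 - u v))]. In the limit where
    all parameters tend to 0, dividing by the two Vandermonde determinants extracts
    the coefficients of a generating function, and after row and column factors
    these are the entries of [1 + M], where [M i j] counts the lattice paths from
    [(i, 0)] to [(0, j + 1)] not ending with a [(0, 1)] step. Expanding
    [det (1 + M)] into principal minors, the Lindstrom-Gessel-Viennot lemma
    identifies it with [T4 n]. *)
From HB Require Import structures.
Require Import Defs.
From mathcomp Require Import all_boot all_order all_algebra.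
From mathcomp Require Import perm algC zify ring.
From Stdlib Require Import FunctionalExtensionality.
Set Implicit Arguments.
Unset Strict Implicit.
Unset Printing Implicit Defensive.
Import Order.TTheory GRing.Theory Num.Theory.
Local Open Scope ring_scope.

(** * Row-to-row operators and the Yang-Baxter equation *)

(** The factor sqrt 2 comes from splitting a vertex with twenty equal weights into three crossings
    of lines drawn at 0, 45 and 90 degrees. All crossings share the anisotropy 1 / sqrt 2, so they
    belong to one solution of the Yang-Baxter equation. The two boundary conditions differ on a
    single line, the diagonal of index [n + 1], which is occupied for DWBC1 and empty for DWBC2. A
    diagonal of index at most [n + 1] can be slid out past the corner [(1, 1)], one of index at
    least [n + 1] past [(n, n)]. The distinguishing line can go either way, and each condition
    selects the corner where the line acts trivially. The limit of equal parameters is purely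
    algebraic. The parameters are distinct multiples of an indeterminate, denominators are cleared,
    and the power of the indeterminate produced by the Vandermonde determinants is cancelled before
    evaluation at 0. The generating function is used in truncated form, with a remainder divisible
    by a higher power. *)

Definition state (S : finType) : Type := {ffun S -> bool}.

Definition flip2 (S : finType) (i j : S) (s : state S) : state S :=
  [ffun l => s l (+) ((l == i) (+) (l == j))].

Lemma flip2C (S : finType) (i j : S) (s : state S) : flip2 i j s = flip2 j i s.
Proof. by apply/ffunP=> l; rewrite !ffunE [(l == j) (+) _]addbC. Qed.

Lemma flip2K (S : finType) (i j : S) : involutive (@flip2 S i j).
Proof. by move=> s; apply/ffunP=> l; rewrite !ffunE -addbA addbb addbF. Qed.

Lemma flip2_chain (S : finType) (i j k : S) (s : state S) :
  flip2 i j (flip2 j k s) = flip2 i k s.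
Proof.
by apply/ffunP=> l; rewrite !ffunE; do !case: (_ == _); case: (s l).
Qed.

Lemma flip2_AC (S : finType) (i j k l : S) (s : state S) :
  flip2 i j (flip2 k l s) = flip2 k l (flip2 i j s).
Proof. by apply/ffunP=> m; rewrite !ffunE [LHS]addbAC. Qed.

Lemma flip2l (S : finType) (i j : S) (s : state S) : i != j -> flip2 i j s i = ~~ s i.
Proof. by move=> /negPf ij; rewrite ffunE eqxx ij addbT. Qed.

Lemma flip2r (S : finType) (i j : S) (s : state S) : i != j -> flip2 i j s j = ~~ s j.
Proof. by rewrite flip2C eq_sym; exact: flip2l. Qed.

Lemma flip2N (S : finType) (i j k : S) (s : state S) :
  k != i -> k != j -> flip2 i j s k = s k.
Proof. by move=> /negPf ki /negPf kj; rewrite ffunE ki kj !addbF. Qed.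

(** Six-vertex weights of the crossing of two lines [i] and [j], a state telling
    which lines carry a particle: [wa] if both or none do, [wb] if the particle
    stays on its line, [wc] if it moves from [i] to [j], [wd] from [j] to [i]. *)
Record weights (R : Type) := Weights { wa : R; wb : R; wc : R; wd : R }.

(** Operators act by pulling functions back: the value at the state before a crossing is a weighted
    sum of the values after it. In a composite, the outermost operator is therefore the crossing met
    first. *)
Definition lop (S : finType) (R : pzRingType) (w : weights R) (i j : S)
    (f : state S -> R) : state S -> R :=
  fun s => if s i == s j then wa w * f s
           else wb w * f s + (if s i then wc w else wd w) * f (flip2 i j s).

Definition yang_baxter (R : pzRingType) (w w' w'' : weights R) : Prop :=
  [/\ wc w * wa w' * wb w'' + wb w * wc w' * wd w'' = wc w * wb w' * wa w'',
      wc w * wa w' * wc w'' + wb w * wc w' * wb w'' = wa w * wc w' * wa w'',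
      wb w * wd w' * wc w'' + wd w * wa w' * wb w'' = wd w * wb w' * wa w'' &
      [/\ wd w * wc w' * wd w'' = wc w * wd w' * wc w'',
      wb w * wa w' * wc w'' + wd w * wc w' * wb w'' = wa w * wb w' * wc w'',
      wb w * wd w' * wb w'' + wd w * wa w' * wd w'' = wa w * wd w' * wa w'' &
      wc w * wd w' * wb w'' + wb w * wa w' * wd w'' = wa w * wb w' * wd w'']].

(** Lets [ring] prove an equality that is a linear combination of hypotheses, with explicit
    coefficients [x], [y], [z]. *)
Lemma eq_from_combination (R : comPzRingType) (x y z p p' q q' t t' u v : R) :
  p = p' -> q = q' -> t = t' ->
  u - v = x * (p - p') + y * (q - q') + z * (t - t') -> u = v.
Proof. by move=> -> -> ->; rewrite !subrr !mulr0 !addr0 => /subr0_eq. Qed.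

(** The three flips and the identity form a Klein four-group, and particle conservation leaves at
    most three reachable states. Comparing the coefficients of [f] at these states for each of the
    six non-constant triples of bits gives the scalar relations of [yang_baxter]. *)
Lemma lop_yang_baxter (S : finType) (R : comPzRingType) (w w' w'' : weights R)
    (i j k : S) (f : state S -> R) :
  yang_baxter w w' w'' -> i != j -> i != k -> j != k ->
  lop w i j (lop w' i k (lop w'' j k f)) = lop w'' j k (lop w' i k (lop w i j f)).
Proof.
case: w w' w'' => [a b c d] [a' b' c' d'] [a'' b'' c'' d''] [/=].
move=> e1 e2 e3 [e4 e5 e6 e7] ij ik jk; apply: functional_extensionality => s.
have ji : j != i by rewrite eq_sym.
have ki : k != i by rewrite eq_sym.
have kj : k != j by rewrite eq_sym.
have c1 : flip2 i j (flip2 i k s) = flip2 j k s by rewrite (flip2C i j) flip2_chain.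
have c2 : flip2 i k (flip2 i j s) = flip2 j k s by rewrite (flip2C i k) flip2_chain flip2C.
have c3 : flip2 j k (flip2 i j s) = flip2 i k s by rewrite (flip2C j k) (flip2C i j) flip2_chain flip2C.
have c4 : flip2 i j (flip2 j k s) = flip2 i k s by rewrite flip2_chain.
have c5 : flip2 i k (flip2 j k s) = flip2 i j s by rewrite (flip2C j k) flip2_chain.
have c6 : flip2 j k (flip2 i k s) = flip2 i j s by rewrite (flip2C i k) flip2_chain flip2C.
have E := (c1, c2, c3, c4, c5, c6, flip2K).
rewrite /lop.
case si: (s i); case sj: (s j); case sk: (s k);
  rewrite ?(si, sj, sk) /=;
  do 6? rewrite ?(flip2l, flip2r, flip2N, si, sj, sk, E, negbK) //=.
- by ring.
- by apply: (eq_from_combination (x := - f (flip2 i k s)) (y := - f (flip2 j k s)) (z := 0) e2 e5 e4); ring.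
- by apply: (eq_from_combination (x := - f (flip2 i j s)) (y := f (flip2 j k s)) (z := - f s) e1 e7 e4); ring.
- by apply: (eq_from_combination (x := f (flip2 i j s)) (y := f (flip2 i k s)) (z := 0) e1 e2 e4); ring.
- by apply: (eq_from_combination (x := f (flip2 i j s)) (y := f (flip2 i k s)) (z := 0) e3 e6 e4); ring.
- by apply: (eq_from_combination (x := - f (flip2 i j s)) (y := f (flip2 j k s)) (z := f s) e3 e5 e4); ring.
- by apply: (eq_from_combination (x := - f (flip2 i k s)) (y := - f (flip2 j k s)) (z := 0) e6 e7 e4); ring.
- by ring.
Qed.

(** * Sliding a diagonal line through a grid *)

Section DiagonalSliding.
Variables (M : Type) (one : M) (mul : Monoid.law one).
Local Notation "x * y" := (mul x y).
Local Notation comm x y := (x * y = y * x).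

Let mulA x y z : x * (y * z) = x * y * z. Proof. exact: Monoid.mulmA. Qed.
Let mul1x x : one * x = x. Proof. exact: Monoid.mul1m. Qed.
Let mulx1 x : x * one = x. Proof. exact: Monoid.mulm1. Qed.

Lemma comm_bigr (I : Type) (l : seq I) (a : M) (F : I -> M) (P : pred I) :
  all P l -> (forall i, P i -> comm a (F i)) -> comm a (\big[mul/one]_(i <- l) F i).
Proof.
move=> + aF; elim: l => [|i l IHl] /=; first by rewrite big_nil mulx1 mul1x.
case/andP=> Pi /IHl al; rewrite big_cons mulA (aF _ Pi) -!mulA al; by [].
Qed.

Lemma big_iotaS (F : nat -> M) (k : nat) :
  \big[mul/one]_(x <- iota 1 k.+1) F x = \big[mul/one]_(x <- iota 1 k) F x * F k.+1.
Proof. by rewrite -[in LHS](addn1 k) iotaD big_cat big_seq1. Qed.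

Lemma rev_iota_split (n m k : nat) : (m + k <= n)%N ->
  rev (iota 1 n) = rev (iota (m + k).+1 (n - (m + k))) ++ rev (iota m.+1 k) ++ rev (iota 1 m).
Proof.
move=> mkn; rewrite -!rev_cat -{1}(subnKC mkn) !iotaD.
by rewrite !add1n.
Qed.

Lemma rev_iota_pred (n m : nat) : (0 < m <= n)%N ->
  rev (iota m.-1.+1 (n - m.-1)) = rev (iota m.+1 (n - m)) ++ [:: m].
Proof.
move=> mn; have -> : (n - m.-1 = (n - m).+1)%N by lia.
by rewrite prednK ?cats1 -?rev_cons; last lia.
Qed.

Variables (n s : nat) (A D : nat -> M) (b : nat -> nat -> M).
Hypothesis s_le : (s <= n.+1)%N.
Hypothesis commA : forall x y y', y != y' -> (0 < x <= n)%N -> (0 < y <= n)%N -> (0 < y' <= n)%N ->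
  comm (A y) (b x y').
Hypothesis commD : forall x x' y, x != x' -> (0 < x <= n)%N -> (0 < x' <= n)%N -> (0 < y <= n)%N ->
  comm (D x) (b x' y).
Hypothesis ybe : forall x y, (0 < x)%N -> (0 < y)%N -> (x + y < s)%N ->
  A y * b x y * D x = D x * b x y * A y.

Let seg x (l : seq nat) := \big[mul/one]_(y <- l) b x y.

(** Column [x] with the diagonal's factor [D x] inserted between the rows [m + 1] and [m]. *)
Let colD x m :=
  seg x (rev (iota m.+1 (n - m))) * D x * seg x (rev (iota 1 m)).

Let inr l := all (fun i => 0 < i <= n)%N l.

Let inr_iota a k : (0 < a)%N -> (a + k <= n.+1)%N -> inr (rev (iota a k)).
Proof. by move=> a0 ak; apply/allP=> i; rewrite mem_rev mem_iota; lia. Qed.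

Let commAseg x y l : (0 < x <= n)%N -> (0 < y <= n)%N -> inr l -> y \notin l -> comm (A y) (seg x l).
Proof.
move=> xn yn ln yl; apply: (@comm_bigr _ _ _ _ (fun y' => (y != y') && (0 < y' <= n)%N)).
  apply/allP=> y' y'l; rewrite (allP ln) // andbT; apply: contraNneq yl => ->; exact: y'l.
by move=> y' /andP[yy' y'n]; apply: commA.
Qed.

Let colD_A x m : (0 < x)%N -> (0 < m)%N -> (x + m < s)%N ->
  colD x m * A m = A m * colD x m.-1.
Proof.
move=> x0 m0 xms; have mn : (0 < m <= n)%N by lia. rewrite /colD.
have -> : rev (iota 1 m) = m :: rev (iota 1 m.-1).
  by case: m m0 {xms mn} => // m _; rewrite -{1}[m.+1]addn1 iotaD rev_cat.
rewrite rev_iota_pred; try lia.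
have c1 : comm (A m) (seg x (rev (iota 1 m.-1))).
  by apply: commAseg; rewrite ?mem_rev ?mem_iota ?inr_iota //; lia.
have c2 : comm (A m) (seg x (rev (iota m.+1 (n - m)))).
  by apply: commAseg; rewrite ?mem_rev ?mem_iota ?inr_iota //; lia.
rewrite /seg big_cons big_cat big_seq1 /= -/(seg x _) -/(seg x _).
rewrite -!mulA -c1 [b x m * (A m * _)]mulA [D x * (_ * _)]mulA.
rewrite [D x * (_ * _)]mulA -ybe // -!mulA.
by rewrite mulA -c2 -!mulA.
Qed.

Let c x y := if (x + y == s)%N then A y * b x y * D x else b x y.

Let cols x (F : nat -> nat -> M) := \big[mul/one]_(y <- rev (iota 1 n)) F x y.

Let segc x l : (forall y, y \in l -> x + y != s)%N -> \big[mul/one]_(y <- l) c x y = seg x l.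
Proof. by move=> h; apply: eq_big_seq => y /h; rewrite /c => /negPf ->. Qed.

Let colc x m : (0 < x)%N -> (0 < m)%N -> (x + m = s)%N -> cols x c = A m * colD x m.-1.
Proof.
move=> x0 m0 xm; have mn : (0 < m <= n)%N by lia.
rewrite /cols.
have -> : rev (iota 1 n) = rev (iota m.+1 (n - m)) ++ m :: rev (iota 1 m.-1).
  by rewrite (@rev_iota_split n m.-1 1) ?addn1 ?prednK //=; lia.
rewrite big_cat big_cons /=.
rewrite !segc; try by move=> y; rewrite mem_rev mem_iota; lia.
rewrite /colD.
rewrite rev_iota_pred; try lia.
have c2 : comm (A m) (seg x (rev (iota m.+1 (n - m)))).
  by apply: commAseg; rewrite ?mem_rev ?mem_iota ?inr_iota //; lia.
rewrite {1}/c xm eqxx /seg big_cat big_seq1 /= -/(seg x _) -/(seg x _).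
by rewrite -!mulA mulA -c2 -!mulA.
Qed.

(** After [j] columns, every factor [D x] stands just above row [s - j - 1], the row of the next
    antidiagonal vertex. The factor [A] of that vertex moves left through the earlier columns, and
    each exchange by [ybe] lets one [D x] drop by a row. *)
Let partial j : (j < s)%N ->
  \big[mul/one]_(x <- iota 1 j) cols x c =
  \big[mul/one]_(y <- rev (iota (s - j) j)) A y *
  \big[mul/one]_(x <- iota 1 j) colD x (s - j).-1.
Proof.
elim: j => [|j IHj] js; first by rewrite !big_nil mulx1.
rewrite !big_iotaS IHj; last lia.
rewrite (@colc _ (s - j.+1)); try lia.
have -> : ((s - j).-1 = s - j.+1)%N by lia.
have -> : rev (iota (s - j.+1) j.+1) = rev (iota (s - j) j) ++ [:: (s - j.+1)%N].
  have -> : (s - j = (s - j.+1).+1)%N by lia.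
  by rewrite cats1 -rev_cons.
have E : \big[mul/one]_(x <- iota 1 j) colD x (s - j.+1) * A (s - j.+1) =
         A (s - j.+1) * \big[mul/one]_(x <- iota 1 j) colD x (s - j.+1).-1.
  have : all (fun x => 0 < x <= j)%N (iota 1 j) by apply/allP=> x; rewrite mem_iota; lia.
  elim: (iota 1 j) => [|x l IHl] /=; first by rewrite !big_nil mulx1 mul1x.
  case/andP=> xj /IHl e; rewrite !big_cons -mulA e [LHS]mulA colD_A -?[LHS]mulA //; lia.
by rewrite big_cat big_seq1 /= -!mulA; congr (_ * _); rewrite mulA E -mulA.
Qed.

Let colD0 x : colD x 0 = cols x b * D x.
Proof. by rewrite /colD subn0 [seg x (rev (iota 1 0))]big_nil mulx1. Qed.

Let Dright k : (k <= n)%N -> \big[mul/one]_(x <- iota 1 k) (cols x b * D x) =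
  \big[mul/one]_(x <- iota 1 k) cols x b * \big[mul/one]_(x <- iota 1 k) D x.
Proof.
elim: k => [|k IHk] kn; first by rewrite !big_nil mulx1.
rewrite !big_iotaS IHk; last lia.
rewrite -!mulA; congr (_ * _); rewrite !mulA; congr (_ * _).
have commDcol x : (0 < x <= k)%N -> comm (D x) (cols k.+1 b).
  move=> xk; apply: (@comm_bigr _ _ _ _ (fun y => 0 < y <= n)%N) => [|y yn].
    exact: inr_iota.
  by apply: commD => //; lia.
have : all (fun x => 0 < x <= k)%N (iota 1 k).
  by apply/allP=> x; rewrite mem_iota; lia.
elim: (iota 1 k) => [|x l IHl] /=; first by rewrite !big_nil mulx1 mul1x.
by case/andP=> xk /IHl e; rewrite !big_cons -mulA e !mulA commDcol.
Qed.

(** Once all [j = s - 1] columns are treated, the factors [D x] lie below the grid rows and commute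
    to the right end. The abstract monoid allows the use of composition in both orders. *)
Lemma slide_diagonal : (0 < s)%N ->
  \big[mul/one]_(x <- iota 1 n) \big[mul/one]_(y <- rev (iota 1 n))
     (if (x + y == s)%N then A y * b x y * D x else b x y) =
  \big[mul/one]_(y <- rev (iota 1 s.-1)) A y *
  \big[mul/one]_(x <- iota 1 n) \big[mul/one]_(y <- rev (iota 1 n)) b x y *
  \big[mul/one]_(x <- iota 1 s.-1) D x.
Proof.
move=> s0; rewrite -/(cols _ _).
have [k sE] : exists k, s = k.+1 by exists s.-1; lia.
have iE : iota 1 n = iota 1 k ++ iota k.+1 (n - k).
  by rewrite -{1}[n](@subnKC k) ?iotaD ?add1n //; lia.
transitivity (\big[mul/one]_(x <- iota 1 k) cols x c *
              \big[mul/one]_(x <- iota k.+1 (n - k)) cols x b).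
  rewrite {1}iE big_cat; congr (_ * _).
  apply: eq_big_seq => x; rewrite mem_iota => xk; apply: eq_big_seq => y.
  by rewrite mem_rev mem_iota => yn; rewrite ifF //; lia.
have ks : (k < s)%N by lia.
rewrite (partial ks); have [-> -> ->] : [/\ (s - k).-1 = 0, s - k = 1 & s.-1 = k]%N by clear -sE; split; lia.
under [X in _ * X * _]eq_bigr => x _ do rewrite colD0.
rewrite Dright; last lia.
rewrite [X in _ = _ * X * _](_ : _ = \big[mul/one]_(x <- iota 1 k) cols x b *
  \big[mul/one]_(x <- iota k.+1 (n - k)) cols x b); last by rewrite {1}iE big_cat.
rewrite -!mulA; congr (_ * (_ * _)); symmetry.
apply: (@comm_bigr _ _ _ _ (fun x => 0 < x <= k)%N) => [|x xk].
  by apply/allP=> x; rewrite mem_iota; lia.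
symmetry; apply: (@comm_bigr _ _ _ _ (fun x' => k < x' <= n)%N) => [|x' x'k].
  by apply/allP=> x'; rewrite mem_iota; lia.
apply: (@comm_bigr _ _ _ _ (fun y => 0 < y <= n)%N) => [|y yn]; first exact: inr_iota.
by apply: commD; lia.
Qed.
End DiagonalSliding.

(** * Removing the diagonal lines of the twenty-vertex model *)

Section Composition.
Variable T : Type.

Definition after (f g : T -> T) : T -> T := fun x => f (g x).
Definition before (f g : T -> T) : T -> T := fun x => g (f x).

Lemma afterA : associative after. Proof. by []. Qed.
Lemma after1f : left_id id after. Proof. by []. Qed.
Lemma afterf1 : right_id id after. Proof. by []. Qed.
HB.instance Definition _ := Monoid.isLaw.Build (T -> T) id after afterA after1f afterf1.

Lemma beforeA : associative before. Proof. by []. Qed.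
Lemma before1f : left_id id before. Proof. by []. Qed.
Lemma beforef1 : right_id id before. Proof. by []. Qed.
HB.instance Definition _ := Monoid.isLaw.Build (T -> T) id before beforeA before1f beforef1.

Lemma big_before (I : Type) (l : seq I) (F : I -> T -> T) :
  \big[before/id]_(i <- l) F i = \big[after/id]_(i <- rev l) F i.
Proof.
elim: l => [|i l IHl]; first by rewrite !big_nil.
by rewrite big_cons rev_cons -cats1 big_cat big_seq1 /= IHl.
Qed.
End Composition.

Definition delta (S : finType) (R : pzRingType) (o : state S) : state S -> R :=
  fun s => (s == o)%:R.

Lemma lop_comm (S : finType) (R : comPzRingType) (w w' : weights R) (i j k l : S) :
  k != i -> k != j -> l != i -> l != j ->
  forall f, lop w i j (lop w' k l f) = lop w' k l (lop w i j f).
Proof.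
move=> ki kj li lj f; apply: functional_extensionality => s.
have ik : i != k by rewrite eq_sym.
have jk : j != k by rewrite eq_sym.
have il : i != l by rewrite eq_sym.
have jl : j != l by rewrite eq_sym.
rewrite /lop !(flip2N, ki, kj, li, lj) // (flip2_AC k l).
by case: (s i == s j); case: (s k == s l); ring.
Qed.

Lemma lop_eq (S : finType) (R : pzRingType) (w : weights R) (i j : S) f (s : state S) :
  s i = s j -> lop w i j f s = wa w * f s.
Proof. by rewrite /lop => ->; rewrite eqxx. Qed.

Lemma lop_delta (S : finType) (R : pzRingType) (w : weights R) (i j : S) (o : state S) :
  i != j -> o i = o j -> lop w i j (delta R o) = (fun s => wa w * delta R o s).
Proof.
move=> ij oij; apply: functional_extensionality => s; rewrite /lop /delta.
case: ifP => // /negP sij; have -> : (s == o) = false.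
  by apply/negP=> /eqP so; apply: sij; rewrite so oij.
rewrite (_ : (flip2 i j s == o) = false) ?mulr0 ?addr0 //.
apply/negP=> /eqP so; apply: sij; rewrite -(inj_eq negb_inj).
by rewrite -(flip2l s ij) -(flip2r s ij) so oij.
Qed.

(** The vertex of three lines whose weight is 1 on all the twenty states
    preserving the number of particles. *)
Definition vertex20 (S : finType) (R : pzRingType) (i j k : S)
    (f : state S -> R) : state S -> R := fun s =>
  f s + (if s i == s j then 0 else f (flip2 i j s))
      + (if s i == s k then 0 else f (flip2 i k s))
      + (if s j == s k then 0 else f (flip2 j k s)).

Definition wsquare (R : pzRingType) (r : R) := Weights 1 r 1 1.
Definition wtriangle (R : pzRingType) (t : R) := Weights 1 t t t.

(** With one particle, each transition is realised by a single route of weight 1 or [r * t], or by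
    two routes of weight [t * t] each. Two particles are treated alike, with particles and holes
    exchanged. *)
Lemma vertex20E (S : finType) (R : comPzRingType) (r t : R) (i j k : S) f :
  r * r = 2 -> r * t = 1 -> i != j -> i != k -> j != k ->
  lop (wtriangle t) i j (lop (wsquare r) i k (lop (wtriangle t) j k f)) =
  vertex20 i j k f.
Proof.
move=> rr rt ij ik jk; apply: functional_extensionality => s.
have rtt : r * t * t = t by rewrite rt mul1r.
have tt2 : 2 * t * t = 1 by transitivity (r * t * (r * t)); [rewrite -rr; ring | rewrite rt mul1r].
have ji : j != i by rewrite eq_sym.
have ki : k != i by rewrite eq_sym.
have kj : k != j by rewrite eq_sym.
have c1 : flip2 i j (flip2 i k s) = flip2 j k s by rewrite (flip2C i j) flip2_chain.
have c4 : flip2 i j (flip2 j k s) = flip2 i k s by rewrite flip2_chain.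
have c5 : flip2 i k (flip2 j k s) = flip2 i j s by rewrite (flip2C j k) flip2_chain.
have c2 : flip2 i k (flip2 i j s) = flip2 j k s by rewrite (flip2C i k) flip2_chain flip2C.
have c3 : flip2 j k (flip2 i j s) = flip2 i k s by rewrite (flip2C j k) (flip2C i j) flip2_chain flip2C.
have c6 : flip2 j k (flip2 i k s) = flip2 i j s by rewrite (flip2C i k) flip2_chain flip2C.
have E := (c1, c2, c3, c4, c5, c6, flip2K).
rewrite /lop /vertex20.
case si: (s i); case sj: (s j); case sk: (s k);
  rewrite ?(si, sj, sk) /=;
  do 6? rewrite ?(flip2l, flip2r, flip2N, si, sj, sk, E, negbK) //=.
all: move: (f s) (f (flip2 i j s)) (f (flip2 i k s)) (f (flip2 j k s)) => x y z u.
- by ring.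
- by apply: (eq_from_combination (x := x + u) (y := 0) (z := 0) rt tt2 tt2); ring.
- by apply: (eq_from_combination (x := y) (y := x + u) (z := 0) rt tt2 tt2); ring.
- by apply: (eq_from_combination (x := x) (y := y + z) (z := 0) rt tt2 tt2); ring.
- by apply: (eq_from_combination (x := x) (y := y + z) (z := 0) rt tt2 tt2); ring.
- by apply: (eq_from_combination (x := y) (y := x + u) (z := 0) rt tt2 tt2); ring.
- by apply: (eq_from_combination (x := x + u) (y := 0) (z := 0) rt tt2 tt2); ring.
- by ring.
Qed.

(** For [r = sqrt 2], [wsquare r] is the crossing of unit directions at 90 degrees, and
    [wtriangle t] the one at 45 degrees divided by sqrt 2. *)
Lemma yang_baxter_triangle (R : comPzRingType) (r t : R) : r * r = 2 -> r * t = 1 ->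
  yang_baxter (wtriangle t) (wsquare r) (wtriangle t).
Proof.
move=> rr rt; have tt2 : 2 * t * t = 1.
  by transitivity (r * t * (r * t)); [rewrite -rr; ring | rewrite rt mul1r].
rewrite /yang_baxter /=; split; [| | |split].
all: try by apply: (eq_from_combination (x := 0) (y := 1) (z := 0) rt tt2 tt2); ring.
all: try by apply: (eq_from_combination (x := -1) (y := 1) (z := 0) rt tt2 tt2); ring.
all: by ring.
Qed.

Section Diagonals.
Variable n : nat.

Definition line : finType := ('I_n.+1 + 'I_n.+1 + 'I_(n + n).+1)%type.
Definition hl (y : nat) : line := inl (inl (inord y)).
Definition vl (x : nat) : line := inl (inr (inord x)).
Definition dl (s : nat) : line := inr (inord s).

Lemma hl_eq y y' : (y <= n)%N -> (y' <= n)%N -> (hl y == hl y') = (y == y').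
Proof.
move=> yn yn'; apply/eqP/eqP => [[/(congr1 val)]|->] //=.
by rewrite !inordK.
Qed.

Lemma vl_eq y y' : (y <= n)%N -> (y' <= n)%N -> (vl y == vl y') = (y == y').
Proof.
move=> yn yn'; apply/eqP/eqP => [[/(congr1 val)]|->] //=.
by rewrite !inordK.
Qed.

Lemma dl_eq y y' : (y <= n + n)%N -> (y' <= n + n)%N -> (dl y == dl y') = (y == y').
Proof.
move=> yn yn'; apply/eqP/eqP => [[/(congr1 val)]|->] //=.
by rewrite !inordK.
Qed.

Variables (R : comPzRingType) (r t : R).
Hypotheses (rr : r * r = 2) (rt : r * t = 1).

Local Notation op := ((state line -> R) -> (state line -> R)).

Definition word (F : nat -> nat -> op) : op :=
  \big[@after _/id]_(x <- iota 1 n) \big[@after _/id]_(y <- rev (iota 1 n)) F x y.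

Let A s y : op := lop (wtriangle t) (hl y) (dl s).
Let B x y : op := lop (wsquare r) (hl y) (vl x).
Let D s x : op := lop (wtriangle t) (dl s) (vl x).
Definition cell20 x y : op := vertex20 (hl y) (dl (x + y)) (vl x).
(** [P] holds on the diagonals already removed, so [word (cell P)] interpolates between the
    twenty-vertex and the six-vertex words. *)
Definition cell (P : pred nat) x y : op :=
  if P (x + y)%N then lop (wsquare r) (hl y) (vl x) else cell20 x y.


Let cell20E x y : cell20 x y = after (after (A (x + y) y) (B x y)) (D (x + y) x).
Proof.
by apply: functional_extensionality => f; rewrite /cell20 -(vertex20E _ rr rt).
Qed.

Let ybe s x y : after (after (A s y) (B x y)) (D s x) = after (after (D s x) (B x y)) (A s y).
Proof.
apply: functional_extensionality => f; rewrite /after /A /B /D.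
by apply: lop_yang_baxter => //; exact: yang_baxter_triangle.
Qed.

Let comm_cell (P : pred nat) (o : op) x y :
  (forall f, o (B x y f) = B x y (o f)) ->
  (~~ P (x + y)%N -> (forall f, o (A (x + y) y f) = A (x + y) y (o f)) /\
                   (forall f, o (D (x + y) x f) = D (x + y) x (o f))) ->
  after o (cell P x y) = after (cell P x y) o.
Proof.
move=> oB oT; apply: functional_extensionality => f; rewrite /after /cell.
case: ifPn => [_|/oT [oA oD]]; first exact: oB.
by rewrite cell20E /after oA oB oD.
Qed.

Let commA (P : pred nat) s x y y' : (0 < s <= n + n)%N -> P s -> y != y' -> (0 < x <= n)%N ->
  (0 < y <= n)%N -> (0 < y' <= n)%N ->
  after (A s y) (cell P x y') = after (cell P x y') (A s y).
Proof.
move=> sn Ps yy' xn yn yn'.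
have hh : hl y' != hl y by rewrite hl_eq ?(eq_sym y') //; lia.
apply: comm_cell => [f|nP]; first exact: lop_comm.
have dd : dl (x + y') != dl s.
  by rewrite dl_eq; try lia; apply: contraNneq nP => ->.
by split=> f; apply: lop_comm.
Qed.

Let commD (P : pred nat) s x x' y : (0 < s <= n + n)%N -> P s -> x != x' -> (0 < x <= n)%N ->
  (0 < x' <= n)%N -> (0 < y <= n)%N ->
  after (D s x) (cell P x' y) = after (cell P x' y) (D s x).
Proof.
move=> sn Ps xx' xn xn' yn.
have hh : vl x' != vl x by rewrite vl_eq ?(eq_sym x') //; lia.
apply: comm_cell => [f|nP]; first exact: lop_comm.
have dd : dl (x' + y) != dl s.
  by rewrite dl_eq; try lia; apply: contraNneq nP => ->.
by split=> f; apply: lop_comm.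
Qed.

(** The smaller diagonals must be gone, because the Yang-Baxter equation is applied at the vertices
    with [x + y < s] and needs a bare six-vertex crossing there. At other vertices, those on a
    different diagonal, only commutation of disjoint lines is used. *)
Lemma word_remove_low (P : pred nat) s : (0 < s <= n.+1)%N -> ~~ P s ->
  (forall s', s' < s -> P s')%N -> exists ly lx : seq nat,
  [/\ {in ly, forall y, 0 < y <= n}%N, {in lx, forall x, 0 < x <= n}%N &
  word (cell P) = after (after (\big[@after _/id]_(y <- ly) A s y)
    (word (cell (predU1 s P)))) (\big[@after _/id]_(x <- lx) D s x)].
Proof.
move=> sn nPs Plow; exists (rev (iota 1 s.-1)), (iota 1 s.-1).
split; try by move=> i; rewrite ?mem_rev mem_iota; lia.
 have Ps : predU1 s P s by rewrite /= eqxx.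
rewrite -(@slide_diagonal _ _ (@after _) n s (A s) (D s) (cell (predU1 s P))); try lia.
- apply: eq_bigr => x _; apply: eq_bigr => y _.
  case: eqP => [xy|/eqP/negPf xy].
    by rewrite /cell xy /= eqxx (negPf nPs) cell20E xy.
  by rewrite /cell /= xy.
- by move=> x y y' yy' xn yn yn'; apply: commA => //; lia.
- by move=> x x' y xx' xn xn' yn; apply: commD => //; lia.
- move=> x y x0 y0 xys; rewrite /cell ifT; last by rewrite /= Plow ?orbT.
  exact: ybe.
Qed.

Lemma map_subn_iota : [seq (n.+1 - i)%N | i <- iota 1 n] = rev (iota 1 n).
Proof.
apply: (@eq_from_nth _ 0%N) => [|i]; first by rewrite size_map size_rev.
rewrite size_map size_iota => ilt; rewrite (nth_map 0%N) ?size_iota // nth_rev ?size_iota //.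
by rewrite !nth_iota; lia.
Qed.

Lemma word_rev (F : nat -> nat -> op) :
  word F = \big[@before _/id]_(x <- iota 1 n) \big[@before _/id]_(y <- rev (iota 1 n))
             F (n.+1 - x)%N (n.+1 - y)%N.
Proof.
have iE : iota 1 n = [seq (n.+1 - i)%N | i <- rev (iota 1 n)].
  by rewrite map_rev map_subn_iota revK.
rewrite big_before /word {1}iE big_map; apply: eq_bigr => x _.
by rewrite big_before revK -map_subn_iota big_map.
Qed.

(** The half-turn of the grid reverses the order of composition and exchanges the two sides of the
    Yang-Baxter equation. It sends the diagonal [s] to [2 n + 2 - s], which is at most [n + 1], so
    the sliding lemma applies with [before]. *)
Lemma word_remove_up (P : pred nat) s : (n < s <= n + n)%N -> ~~ P s ->
  (forall s', s < s' -> P s')%N -> exists ly lx : seq nat,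
  [/\ {in ly, forall y, 0 < y <= n}%N, {in lx, forall x, 0 < x <= n}%N &
  word (cell P) = after (after (\big[@after _/id]_(x <- lx) D s x)
    (word (cell (predU1 s P)))) (\big[@after _/id]_(y <- ly) A s y)].
Proof.
move=> sn nPs Pup; have Ps : predU1 s P s by rewrite /= eqxx.
pose s' := ((n + n).+2 - s)%N.
pose D' x := D s (n.+1 - x)%N; pose A' y := A s (n.+1 - y)%N.
pose b' x y := cell (predU1 s P) (n.+1 - x)%N (n.+1 - y)%N.
exists [seq (n.+1 - i)%N | i <- iota 1 s'.-1], [seq (n.+1 - i)%N | i <- rev (iota 1 s'.-1)].
split; try by move=> i /mapP[j]; rewrite ?mem_rev mem_iota /s'; lia.
suff -> : word (cell P) = before (before (\big[@before _/id]_(y <- rev (iota 1 s'.-1)) A' y)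
    (word (cell (predU1 s P)))) (\big[@before _/id]_(x <- iota 1 s'.-1) D' x).
  by rewrite !big_before revK !big_map.
rewrite [in RHS]word_rev -(@slide_diagonal _ _ (@before _) n s' A' D' b'); first last.
- by rewrite /s'; lia.
- move=> x y x0 y0 xys; rewrite /b' /cell ifT; last by rewrite /= Pup ?orbT //; lia.
  symmetry; exact: ybe.
- by move=> x x' y xx' xn xn' yn; symmetry; apply: commD => //; lia.
- by move=> x y y' yy' xn yn yn'; symmetry; apply: commA => //; lia.
- by rewrite /s'; lia.
rewrite word_rev; apply: eq_big_seq => x; rewrite mem_iota => xn.
apply: eq_big_seq => y; rewrite mem_rev mem_iota => yn.
have -> : (x + y == s')%N = (n.+1 - x + (n.+1 - y) == s)%N by rewrite /s'; lia.
rewrite /b'; case: eqP => [xy|/eqP/negPf xy].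
  rewrite /cell xy /= (negPf nPs) eqxx cell20E xy; exact: ybe.
by rewrite /cell /= xy.
Qed.

(** Boundary states of [word]: the particles enter by the horizontal lines and
    leave by the vertical ones, and the diagonals up to [m] keep a particle, with
    [m = n.+1] for DWBC1 and [m = n] for DWBC2. Lines are numbered from 1; the
    lines of index 0 meet no vertex. *)
Definition bit_at (hb vb : bool) (m : nat) (l : 'I_n.+1 + 'I_n.+1 + 'I_(n + n).+1) :=
  match l with
  | inl (inl y) => hb && (0 < y)%N
  | inl (inr x) => vb && (0 < x)%N
  | inr s => (s <= m)%N
  end.
Definition state_in (m : nat) : state line := [ffun l => bit_at true false m l].
Definition state_out (m : nat) : state line := [ffun l => bit_at false true m l].

Lemma big_after_fix (l : seq nat) (F : nat -> op) f :
  {in l, forall i, F i f = f} -> (\big[@after _/id]_(i <- l) F i) f = f.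
Proof.
elim: l => [|i l IHl] Ff; rewrite ?big_nil // big_cons /after IHl ?Ff ?mem_head //.
by move=> j jl; rewrite Ff // inE jl orbT.
Qed.

Lemma big_after_eval (l : seq nat) (F : nat -> op) f s :
  {in l, forall i g, F i g s = g s} -> (\big[@after _/id]_(i <- l) F i) f s = f s.
Proof.
elim: l => [|i l IHl] Ff; rewrite ?big_nil // big_cons /after Ff ?mem_head //.
by apply: IHl => j jl g; rewrite Ff // inE jl orbT.
Qed.

(** An occupied diagonal, slid past [(1, 1)], crosses rows at their entrance and columns at their
    exit, all occupied. An empty one, slid past [(n, n)], crosses columns at their entrance and rows
    at their exit, all empty. Equal bits give the weight [wa = 1]. The bounds on [m] are those which
    the two removals impose on [s]. *)
Lemma word_predU1 (m : nat) (P : pred nat) s : (n <= m <= n.+1)%N -> (0 < s <= n + n)%N ->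
  ~~ P s -> (if s <= m then forall s', s' < s -> P s' else forall s', s < s' -> P s')%N ->
  word (cell P) (delta R (state_out m)) (state_in m) =
  word (cell (predU1 s P)) (delta R (state_out m)) (state_in m).
Proof.
move=> mn sn nPs; case: leqP => [sm Ps|ms Ps].
- have [|ly [lx [lyn lxn ->]]] := word_remove_low _ nPs Ps; first by lia.
  rewrite /after (@big_after_fix lx (D s)) => [|x /lxn xn].
    rewrite big_after_eval // => y /lyn yn g; rewrite /A lop_eq ?mul1r // !ffunE /= !inordK //; lia.
  rewrite /D lop_delta // ?ffunE /= ?inordK; try lia.
  by apply: functional_extensionality => z; rewrite mul1r.
- have [|ly [lx [lyn lxn ->]]] := word_remove_up _ nPs Ps; first by lia.
  rewrite /after (@big_after_fix ly (A s)) => [|y /lyn yn].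
    rewrite big_after_eval // => x /lxn xn g; rewrite /D lop_eq ?mul1r // !ffunE /= !inordK //; lia.
  rewrite /A lop_delta // ?ffunE /= ?inordK; try lia.
  by apply: functional_extensionality => z; rewrite mul1r.
Qed.

Lemma eq_word (F G : nat -> nat -> op) :
  (forall x y, (0 < x <= n)%N -> (0 < y <= n)%N -> F x y = G x y) -> word F = word G.
Proof.
move=> FG; apply: eq_big_seq => x; rewrite mem_iota => xn.
by apply: eq_big_seq => y; rewrite mem_rev mem_iota => yn; apply: FG; lia.
Qed.

Lemma word20_word6 (m : nat) : (n <= m <= n.+1)%N ->
  word cell20 (delta R (state_out m)) (state_in m) =
  word (fun x y => lop (wsquare r) (hl y) (vl x)) (delta R (state_out m)) (state_in m).
Proof.
move=> mn; pose val P := word (cell P) (delta R (state_out m)) (state_in m).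
have eqv P Q : (forall s, 1 < s <= n + n -> P s = Q s)%N -> val P = val Q.
  move=> PQ; congr (_ _ _); apply: eq_word => x y xn yn.
  by rewrite /cell PQ //; lia.
have low k : (k <= m)%N -> (k <= n + n)%N -> val (fun s => (s < 1)%N) = val (fun s => (s < k.+1)%N).
  elim: k => [//|k IHk] km kn; rewrite IHk; try lia.
  rewrite /val (@word_predU1 m _ k.+1) //; try lia.
    by apply: eqv => s sn /=; lia.
  by rewrite km.
have up k : (m + k <= n + n)%N -> val (fun s => s <= m)%N = val (fun s => (s <= m) || (n + n - k < s))%N.
  elim: k => [|k IHk] km; first by apply: eqv => s sn; lia.
  rewrite IHk; last lia.
  rewrite /val (@word_predU1 m _ (n + n - k)%N) //; try lia.
    by apply: eqv => s sn /=; lia.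
  by rewrite ifF; last lia; move=> s'; lia.
have -> : word cell20 (delta R (state_out m)) (state_in m) = val (fun s => (s < 1)%N).
  by congr (_ _ _); apply: eq_word => x y xn yn; rewrite /cell ifF //; lia.
have -> : word (fun x y => lop (wsquare r) (hl y) (vl x)) (delta R (state_out m)) (state_in m) = val predT.
  by congr (_ _ _); apply: eq_word => x y xn yn; rewrite /cell.
case: (leqP m (n + n)) => [mnn|nnm]; last by apply: eqv => s; lia.
rewrite (low m) // (_ : val _ = val (fun s => s <= m)%N); last by apply: eqv => s; lia.
by rewrite (up (n + n - m)%N); [apply: eqv => s /= ; lia | lia].
Qed.
End Diagonals.

(** * The six-vertex model with domain wall boundary conditions *)

(** Weights of the crossing of two lines of directions [(p, q)] and [(p', q')]. *)
Definition wlines (R : pzRingType) (r : R) (l l' : R * R) : weights R :=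
  let d := l.1 * l'.2 - l.2 * l'.1 in
  Weights (l.1 * l'.1 + l.2 * l'.2 + d) (r * d) (l.1 ^+ 2 + l.2 ^+ 2) (l'.1 ^+ 2 + l'.2 ^+ 2).

(** For unit directions at angle theta and [r = sqrt 2], the weights are
    [a = sqrt 2 sin(theta + pi/4)], [b = sqrt 2 sin theta] and [c = d = 1], the trigonometric
    six-vertex weights. Unnormalised directions make them polynomial. *)
Lemma yang_baxter_lines (R : comPzRingType) (r : R) (l l' l'' : R * R) : r * r = 2 ->
  yang_baxter (wlines r l l') (wlines r l l'') (wlines r l' l'').
Proof.
case: l l' l'' => [p q] [p' q'] [p'' q''] rr; rewrite /yang_baxter /=.
by split; [| | |split]; ring: rr.
Qed.

Section Grid.
Variables (S : finType) (R : comPzRingType) (w : S -> S -> weights R).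
Implicit Types (H V : seq S) (f g : state S -> R) (s o : state S).

Definition col (x : S) H f := foldr (fun y g => lop (w y x) y x g) f H.
Definition grid H V f := foldr (fun x g => col x H g) f V.

Lemma col_cat x H H' f : col x (H ++ H') f = col x H (col x H' f).
Proof. by rewrite /col foldr_cat. Qed.

Lemma lop_scale (w0 : weights R) i j a f :
  lop w0 i j (fun s => a * f s) = (fun s => a * lop w0 i j f s).
Proof.
apply: functional_extensionality => s; rewrite /lop; case: ifP => _; ring.
Qed.

Lemma col_scale x H a f : col x H (fun s => a * f s) = (fun s => a * col x H f s).
Proof. by elim: H => //= y H ->; rewrite lop_scale. Qed.

Lemma grid_scale H V a f : grid H V (fun s => a * f s) = (fun s => a * grid H V f s).
Proof.
by elim: V => //= x V ->; rewrite col_scale.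
Qed.

(** Locality: a function may be replaced by one that agrees with it only while the untouched lines
    keep their bits. *)
Lemma lop_ext (w0 : weights R) i j f g s :
  (forall s', (forall l, l != i -> l != j -> s' l = s l) -> f s' = g s') ->
  lop w0 i j f s = lop w0 i j g s.
Proof.
move=> fg; rewrite /lop !fg // => l li lj; exact: flip2N.
Qed.

Lemma col_ext x H f g s :
  (forall s', (forall l, l != x -> l \notin H -> s' l = s l) -> f s' = g s') ->
  col x H f s = col x H g s.
Proof.
elim: H s => [|y H IHH] s fg /=; first exact: fg.
apply: lop_ext => s' s's; apply: IHH => s'' s''s'; apply: fg => l lx.
by rewrite inE negb_or => /andP[ly lH]; rewrite s''s' ?s's.
Qed.

Definition dwbc_state H V s := [/\ uniq (H ++ V), {in H, forall l, s l} & {in V, forall l, ~~ s l}].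
Definition dwbc_flip H V s : state S :=
  [ffun l => if l \in H then false else if l \in V then true else s l].
Definition Z6 H V s := grid H V (delta R (dwbc_flip H V s)) s.

Lemma grid_swap (w0 : weights R) H1 H2 i k V f :
  uniq ((H1 ++ i :: k :: H2) ++ V) ->
  (forall x, x \in V -> yang_baxter w0 (w i x) (w k x)) ->
  lop w0 i k (grid (H1 ++ i :: k :: H2) V f) = grid (H1 ++ k :: i :: H2) V (lop w0 i k f).
Proof.
move=> + + ; elim: V => // x V IHV un yb.
have {IHV} IH : lop w0 i k (grid (H1 ++ i :: k :: H2) V f) = grid (H1 ++ k :: i :: H2) V (lop w0 i k f).
  apply: IHV => [|x' x'V]; last by apply: yb; rewrite inE x'V orbT.
  by apply: subseq_uniq un; rewrite cat_subseq // subseq_cons.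
rewrite /= -IH; move: (grid _ V f) => g; rewrite !col_cat /=.
have {yb} yb := yb x (mem_head _ _).
have {un} : uniq (i :: k :: x :: H1 ++ H2 ++ V).
  rewrite -(perm_uniq (_ : perm_eq ((H1 ++ i :: k :: H2) ++ x :: V) _)) //.
  apply/seq.permP=> a; rewrite !(count_cat, count_cat, count_cat) /= !count_cat /=; lia.
rewrite !cons_uniq !inE !mem_cat !negb_or.
case/and4P=> /and5P[ik ix iH1 iH2 _] /and4P[kx kH1 kH2 _] /and3P[xH1 xH2 _] _.
have comm H h : i \notin H -> k \notin H -> x \notin H ->
   lop w0 i k (col x H h) = col x H (lop w0 i k h).
  elim: H => //= y H IHH; rewrite !inE !negb_or => /andP[iy iH] /andP[ky kH] /andP[xy xH].
  rewrite -IHH // lop_comm // eq_sym //.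
by rewrite comm // lop_yang_baxter // comm.
Qed.

(** An extra crossing of the rows [i] and [k] is carried through the grid. Both rows are occupied on
    entry and empty on exit, so at either end it contributes the regular factor [wa w0], which
    cancels. *)
Lemma Z6_swap (w0 : weights R) H1 H2 i k V s :
  GRing.lreg (wa w0) -> dwbc_state (H1 ++ i :: k :: H2) V s ->
  (forall x, x \in V -> yang_baxter w0 (w i x) (w k x)) ->
  Z6 (H1 ++ i :: k :: H2) V s = Z6 (H1 ++ k :: i :: H2) V s.
Proof.
move=> wa_reg [un sH sV] yb; apply: wa_reg; rewrite /Z6.
have -> : dwbc_flip (H1 ++ k :: i :: H2) V s = dwbc_flip (H1 ++ i :: k :: H2) V s.
  by apply/ffunP=> l; rewrite !ffunE !mem_cat !inE; do 2![case: (_ \in _) => //=]; rewrite orbCA.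
set d := delta R _.
have si : s i by apply: sH; rewrite mem_cat !inE eqxx orbT.
have sk : s k by apply: sH; rewrite mem_cat !inE eqxx !orbT.
have ik : i != k.
  by move: un; rewrite -catA cat_uniq => /and3P[_ _]; rewrite !cat_cons cons_uniq inE negb_or => /andP[/andP[]].
rewrite -(@lop_eq _ _ w0 i k) ?si ?sk // grid_swap //; rewrite lop_delta ?grid_scale //.
by rewrite !ffunE !mem_cat !inE !eqxx !orbT.
Qed.

Lemma Z6_head H1 H2 k V s :
  dwbc_state (H1 ++ k :: H2) V s ->
  (forall i, i \in H1 -> exists w0, GRing.lreg (wa w0) /\
     forall x, x \in V -> yang_baxter w0 (w i x) (w k x)) ->
  Z6 (H1 ++ k :: H2) V s = Z6 (k :: H1 ++ H2) V s.
Proof.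
elim/last_ind: H1 H2 => [//|H1 i IH] H2 dw yb.
have [w0 [reg yb0]] := yb i (ltac:(by rewrite mem_rcons mem_head)).
rewrite !cat_rcons in dw *; rewrite (Z6_swap reg) // IH // => [|i' i'H].
  case: dw => un sH sV; split=> // [|l lH].
    apply: etrans un; apply: perm_uniq; rewrite perm_cat2r perm_cat2l.
    by apply/seq.permP=> a /=; lia.
  by apply: sH; move: lH; rewrite !mem_cat !inE orbCA; case: (l \in H1); rewrite //= orbCA.
by apply: yb; rewrite mem_rcons inE i'H orbT.
Qed.

Lemma col_ones x H f s : x \notin H -> uniq H -> s x -> {in H, forall l, s l} ->
  col x H f s = (\prod_(y <- H) wa (w y x)) * f s.
Proof.
move=> xH uH sx; elim: H xH uH => [|y H IHH] /=; first by rewrite big_nil mul1r.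
rewrite inE negb_or => /andP[xy xH] /andP[yH uH] sH.
rewrite lop_eq ?sx ?sH ?mem_head // IHH ?big_cons ?mulrA // => l lH.
by rewrite sH // inE lH orbT.
Qed.

Lemma col_cons_top x y H f s : dwbc_state (y :: H) [:: x] s ->
  col x (y :: H) f s = wb (w y x) * col x H f s +
    wc (w y x) * (\prod_(z <- H) wa (w z x)) * f (flip2 y x s).
Proof.
case=> un sH sx; have {sx} sx : ~~ s x by apply: sx; rewrite mem_head.
have sy : s y by apply: sH; rewrite mem_head.
move: un; rewrite cons_uniq cat_uniq mem_cat mem_seq1 /= orbF andbT negb_or.
move=> /andP[/andP[yH yx] /andP[uH xH]].
rewrite /lop sy (negPf sx) /= (@col_ones _ _ _ (flip2 y x s)) ?mulrA // ?flip2r // => l lH.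
rewrite flip2N ?sH ?inE ?lH ?orbT //; first by apply: contraNneq yH => <-.
by apply: contraNneq xH => <-.
Qed.

Lemma grid_frozen y H V f s : y \notin H -> y \notin V -> uniq (H ++ V) ->
  ~~ s y -> {in V, forall l, ~~ s l} ->
  grid (y :: H) V f s = (\prod_(x <- V) wa (w y x)) * grid H V f s.
Proof.
move=> yH; elim: V s => [|x V IHV] s /=; first by rewrite big_nil mul1r.
rewrite inE negb_or => /andP[yx yV] un sy sV.
have sx : ~~ s x by apply: sV; rewrite mem_head.
rewrite lop_eq ?(negPf sx) ?(negPf sy) // big_cons -mulrA; congr (_ * _).
have un' : uniq (H ++ V) by apply: subseq_uniq un; rewrite cat_subseq // subseq_cons.
rewrite (@col_ext _ _ _ (fun s => (\prod_(x <- V) wa (w y x)) * grid H V f s)).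
  by rewrite col_scale.
move=> s' s's; apply: IHV => //; first by rewrite s's.
move: un; rewrite cat_uniq => /and3P[_ /hasPn nh /andP[xV _]] l lV.
rewrite s's ?sV ?inE ?lV ?orbT //; first by apply: contraTneq lV => ->.
by apply: nh; rewrite inE lV orbT.
Qed.

(** Discards the term in which the first column never receives a particle: no later vertex could
    supply it. *)
Lemma grid_delta_bit H V o f s x : x \notin H -> x \notin V -> o x -> ~~ s x ->
  f = delta R o -> grid H V f s = 0.
Proof.
move=> xH + ox + ->; elim: V s => [|z V IHV] s' /=.
  by move=> _ sx; rewrite /delta; case: eqP => // so; rewrite so ox in sx.
rewrite inE negb_or => /andP[xz xV] sx.
rewrite (@col_ext _ _ _ (fun=> 0)) => [|s'' s's]; last by rewrite IHV // s's.
by elim: H {IHV xH sx} s' => //= y H IHH s'; rewrite /lop !IHH !mulr0 addr0; case: ifP.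
Qed.

Lemma dwbc_state_behead y H x V s : dwbc_state (y :: H) (x :: V) s ->
  dwbc_state H V (flip2 y x s) /\
  dwbc_flip H V (flip2 y x s) = dwbc_flip (y :: H) (x :: V) s.
Proof.
case=> un sH sV; have sy := sH y (mem_head _ _); have sx := sV x (mem_head _ _).
have : uniq (y :: x :: H ++ V).
  rewrite -(perm_uniq (_ : perm_eq ((y :: H) ++ x :: V) _)) //.
  by apply/seq.permP=> a; rewrite /= !count_cat /=; lia.
rewrite !cons_uniq !inE !mem_cat !negb_or => /and3P[/and3P[yx yH yV] /andP[xH xV] un'].
have ne l : l \in H ++ V -> (l != y) && (l != x).
  by rewrite mem_cat => /orP[] lH; apply/andP; split; apply: contraTneq lH => ->.
split; first split=> // l lH.
- by have /andP[ly lx] := ne l (ltac:(by rewrite mem_cat lH)); rewrite flip2N ?sH // inE lH orbT.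
- by have /andP[ly lx] := ne l (ltac:(by rewrite mem_cat lH orbT)); rewrite flip2N ?sV // inE lH orbT.
apply/ffunP=> l; rewrite !ffunE !inE.
case lH: (l \in H); first by rewrite orbT.
case lV: (l \in V); first by rewrite !orbT orbF; case: (ne l (ltac:(by rewrite mem_cat lV orbT))) => /andP[/negPf->].
rewrite !orbF; case: (eqVneq l y) => [->|ly]; first by rewrite (negPf yx) sy.
by case: (eqVneq l x) => [->|lx]; rewrite ?addbF ?(negPf sx).
Qed.

(** When [wb] vanishes, row [y] must pass its particle to column [x] at the corner. Then the column
    is occupied and the row empty, and every other crossing on them joins equal bits. *)
Lemma Z6_frozen y H x V s : dwbc_state (y :: H) (x :: V) s -> wb (w y x) = 0 ->
  Z6 (y :: H) (x :: V) s = wc (w y x) * (\prod_(z <- H) wa (w z x)) *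
    (\prod_(z <- V) wa (w y z)) * Z6 H V (flip2 y x s).
Proof.
move=> dw wb0; have [[un' sH' sV'] fl] := dwbc_state_behead dw.
have [un sH sV] := dw; rewrite /Z6 [LHS]/= [LHS]col_cons_top ?wb0; last first.
  split=> // [|l lV]; last by apply: sV; move: lV; rewrite !inE => ->.
  by apply: subseq_uniq un; rewrite cat_subseq // sub1seq mem_head.
rewrite mul0r add0r -fl -!mulrA; congr (_ * (_ * _)).
have : uniq (y :: x :: H ++ V).
  rewrite -(perm_uniq (_ : perm_eq ((y :: H) ++ x :: V) _)) //.
  by apply/seq.permP=> a; rewrite /= !count_cat /=; lia.
rewrite !cons_uniq !inE !mem_cat !negb_or => /and3P[/and3P[yx yH yV] /andP[xH xV] _].
by apply: grid_frozen; rewrite // flip2l // sH // mem_head.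
Qed.

(** The column takes its particle from exactly one row [k]. The rows met before keep their particle
    across an empty column, those met after cross an occupied one. *)
Lemma Z6_cons H x V s : dwbc_state H (x :: V) s ->
  Z6 H (x :: V) s = \sum_(k < size H) (\prod_(z <- take k H) wb (w z x)) *
    wc (w (nth x H k) x) * (\prod_(z <- drop k.+1 H) wa (w z x)) *
    grid H V (delta R (dwbc_flip H (x :: V) s)) (flip2 (nth x H k) x s).
Proof.
case=> un sH sV; rewrite /Z6 [LHS]/=; set f := grid _ _ _.
have sx : ~~ s x by apply: sV; rewrite mem_head.
have : uniq (x :: H ++ V).
  rewrite -(perm_uniq (_ : perm_eq (H ++ x :: V) _)) //.
  by apply/seq.permP=> a; rewrite /= !count_cat /=; lia.
rewrite cons_uniq mem_cat negb_or => /andP[/andP[xH xV] un'].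
have fs0 : f s = 0.
  rewrite /f; apply: (@grid_delta_bit _ _ _ _ _ x) => //.
  by rewrite ffunE (negPf xH) mem_head.
move: f fs0 => f fs0; move: un'; rewrite cat_uniq => /andP[uH _] {un}.
elim: H uH xH sH => [|y H IHH] uH xH sH /=; first by rewrite big_ord0.
rewrite [LHS]col_cons_top; last first.
  split=> [|//|l]; last by rewrite inE => /eqP->.
  by rewrite cat_uniq uH /= orbF xH.
rewrite big_ord_recl /= big_nil mul1r drop0 addrC; congr (_ + _).
rewrite IHH; first last.
- by move=> l lH; rewrite sH // inE lH orbT.
- by apply: contraNN xH => xH; rewrite inE xH orbT.
- by case/andP: uH.
rewrite big_distrr; apply: eq_bigr => k _ /=.
by rewrite big_cons !mulrA.
Qed.
End Grid.

(** * The Izergin-Korepin determinant *)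

Section RemoveNth.
Variable T : eqType.
Implicit Types (l : seq T) (k i : nat).

Definition remove_nth k l := take k l ++ drop k.+1 l.

Lemma cat_remove_nth (x0 : T) k l : (k < size l)%N -> l = take k l ++ nth x0 l k :: drop k.+1 l.
Proof. by move=> kl; rewrite -drop_nth // cat_take_drop. Qed.

Lemma size_remove_nth k l : (k < size l)%N -> size (remove_nth k l) = (size l).-1.
Proof. by move=> kl; rewrite size_cat size_take size_drop kl; lia. Qed.

Lemma perm_remove_nth (x0 : T) k l : (k < size l)%N -> perm_eq l (nth x0 l k :: remove_nth k l).
Proof.
move=> kl; apply/seq.permP=> a; rewrite {1}(cat_remove_nth x0 kl) /remove_nth /= !count_cat /=; lia.
Qed.

Lemma nth_remove_nth (x0 : T) k l i : (k < size l)%N -> nth x0 (remove_nth k l) i = nth x0 l (bump k i).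
Proof.
move=> kl; rewrite nth_cat size_take kl /bump; case: ltnP => ik.
  by rewrite nth_take // leqNgt ik.
by rewrite nth_drop; congr nth; lia.
Qed.

Lemma map_remove_nth (T' : eqType) (f : T -> T') k l : map f (remove_nth k l) = take k (map f l) ++ drop k.+1 (map f l).
Proof. by rewrite map_cat map_take map_drop. Qed.
End RemoveNth.

Section Vdm.
Variable R : comNzRingType.

Fixpoint vdm (l : seq R) : R :=
  if l is x :: l' then \prod_(y <- l') (x - y) * vdm l' else 1.

Lemma vdm_remove_nth k l : (k < size l)%N ->
  vdm l = (-1) ^+ k * (\prod_(y <- remove_nth k l) (nth 0 l k - y) * vdm (remove_nth k l)).
Proof.
elim: l k => // x l IHl [|k] /= kl.
  by rewrite /remove_nth /= drop0 expr0 mul1r.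
rewrite (IHl k) //= -[in RHS]cat1s -[remove_nth k.+1 _]/(x :: remove_nth k l) big_cons /=.
rewrite (perm_big _ (perm_remove_nth 0 kl)) big_cons exprS /=.
by rewrite -[x - _ in LHS]opprB; ring.
Qed.
End Vdm.

Section IzerginKorepin.
Variables (S : finType) (F : fieldType) (r : F).
Hypothesis rr : r * r = 2.
Implicit Types (H V : seq S) (u v : S -> F) (s : state S).

(** At [u = v = 0] these are the homogeneous weights [wsquare r]. *)
Definition wparam u v (y x : S) := wlines r (1, - u y) (- v x, 1).
Definition acoef (a b : F) := 1 - a - b - a * b.
Definition abcoef (a b : F) := acoef a b * (1 - a * b).

Lemma wparam_a u v y x : wa (wparam u v y x) = acoef (u y) (v x).
Proof. by rewrite /wparam /acoef /=; ring. Qed.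
Lemma wparam_b u v y x : wb (wparam u v y x) = r * (1 - u y * v x).
Proof. by rewrite /wparam /=; ring. Qed.
Lemma wparam_c u v y x : wc (wparam u v y x) = 1 + u y ^+ 2.
Proof. by rewrite /wparam /=; ring. Qed.

(** The inverses of the nonzero [u h] serve as interpolation points, where the weight [b] vanishes.
    The last condition says that the weight [a] of the crossing of two rows is nonzero, which allows
    exchanging them. *)
Definition generic H u := [/\ uniq (map u H), {in H, forall h, u h != 0} &
  {in H &, forall h h', 1 + u h * u h' + u h - u h' != 0}].

Lemma Z6_remove_nth H V u v s k x0 : (k < size H)%N -> generic H u -> dwbc_state H V s ->
  Z6 (wparam u v) H V s = Z6 (wparam u v) (nth x0 H k :: remove_nth k H) V s.
Proof.
move=> kH [_ _ gen] dw; rewrite {1}(cat_remove_nth x0 kH) Z6_head //.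
  by rewrite -(cat_remove_nth x0 kH).
move=> i iH; exists (wlines r (1, - u i) (1, - u (nth x0 H k))); split.
  apply/lregP; have := gen _ _ (mem_take iH) (mem_nth x0 kH); apply: contraNN => /eqP <-.
  by apply/eqP; rewrite /=; ring.
by move=> x xV; apply: yang_baxter_lines.
Qed.

Definition IKmatrix H V u v (n : nat) x0 : 'M[F]_n :=
  \matrix_(j, i) (abcoef (u (nth x0 H i)) (v (nth x0 V j)))^-1.

Lemma expand_first_row n (M : 'M[F]_n.+1) :
  \det M = \sum_(k < n.+1) (-1) ^+ k * M 0 k * \det (\matrix_(i, j) M (lift 0 i) (lift k j)).
Proof.
rewrite (expand_det_row M 0); apply: eq_bigr => k _.
rewrite /cofactor add0n mulrA [M 0 k * _]mulrC; congr (_ * \det _).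
by apply/matrixP=> i j; rewrite !mxE.
Qed.

(** The partition function as a polynomial in the parameter of the first column,
    [Y k] standing for the contribution of the other columns when that column
    takes its particle from the [k]-th row. *)
Definition Z6poly H x0 u (Y : nat -> F) : {poly F} :=
  \sum_(k < size H) (\prod_(z <- take k H) (r%:P * (1 - (u z) *: 'X))) *
    ((1 + u (nth x0 H k) ^+ 2) * Y k)%:P *
    (\prod_(z <- drop k.+1 H) ((1 - u z)%:P - (1 + u z) *: 'X)).

Lemma size_mul_leq (p q : {poly F}) m k :
  (size p <= m.+1)%N -> (size q <= k.+1)%N -> (size (p * q)%R <= (m + k).+1)%N.
Proof.
move=> pm qk; apply: (leq_trans (size_polyMleq _ _)).
by rewrite -subn1 leq_subLR add1n -addSn -addnS leq_add.
Qed.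

Lemma size_prod_linear (I : Type) (l : seq I) (p : I -> {poly F}) :
  (forall i, size (p i) <= 2)%N -> (size (\prod_(i <- l) p i)%R <= (size l).+1)%N.
Proof.
move=> p2; elim: l => [|i l IHl]; first by rewrite big_nil size_poly1.
by rewrite big_cons /= -[(size l).+1]add1n size_mul_leq.
Qed.

Lemma size_prod_quadratic (I : Type) (l : seq I) (p : I -> {poly F}) :
  (forall i, size (p i) <= 3)%N ->
  (size (\prod_(i <- l) p i)%R <= (size l + size l).+1)%N.
Proof.
move=> p3; elim: l => [|i l IHl]; first by rewrite big_nil size_poly1.
rewrite big_cons /= addnS addSn -addn2 addnC; exact: (@size_mul_leq _ _ 2).
Qed.

Lemma size_linear_poly (a b : F) : (size (a%:P - b *: 'X)%R <= 2)%N.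
Proof.
apply: (leq_trans (size_polyD _ _)); rewrite size_polyN geq_max.
rewrite (leq_trans (size_polyC_leq1 _)) //=.
by apply: (leq_trans (size_scale_leq _ _)); rewrite size_polyX.
Qed.

Lemma size_Z6poly H x0 u Y : (size (Z6poly H x0 u Y) <= size H)%N.
Proof.
apply: (leq_trans (size_sum _ _ _)); apply/bigmax_leqP => k _.
have kH := ltn_ord k; rewrite [X in (_ <= X)%N](_ : _ = (k + 0 + (size H - k.+1)).+1); last lia.
apply: size_mul_leq; first apply: size_mul_leq (size_polyC_leq1 _).
- apply: leq_trans (size_prod_linear _ _) _ => [z|]; last by rewrite size_take kH.
  by apply: (@size_mul_leq _ _ 0 1); rewrite ?size_polyC_leq1 // -polyC1 size_linear_poly.
- apply: leq_trans (size_prod_linear _ _) _ => [z|]; first exact: size_linear_poly.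
  by rewrite size_drop.
Qed.

Definition update (v : S -> F) (x : S) (t : F) : S -> F := fun l => if l == x then t else v l.

Lemma grid_update H V u v x t f : x \notin V -> grid (wparam u (update v x t)) H V f = grid (wparam u v) H V f.
Proof.
elim: V => //= z V IHV; rewrite inE negb_or => /andP[xz xV]; rewrite IHV //.
move: (grid _ _ _ f) => g; elim: H {IHV} => //= y H ->; congr (lop _ _ _ _).
by rewrite /wparam /update eq_sym (negPf xz).
Qed.

Lemma Z6_update H x V u v s t : dwbc_state H (x :: V) s ->
  Z6 (wparam u (update v x t)) H (x :: V) s =
  (Z6poly H x u (fun k => grid (wparam u v) H V (delta F (dwbc_flip H (x :: V) s)) (flip2 (nth x H k) x s))).[t].
Proof.
move=> dw; rewrite Z6_cons // horner_sum; apply: eq_bigr => k _.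
have xV : x \notin V by case: dw; rewrite cat_uniq => /and3P[_ _ /andP[]].
rewrite !hornerM !horner_prod hornerC grid_update // wparam_c.
under eq_bigr => z _ do rewrite wparam_b /update eqxx.
under [X in _ * X * _]eq_bigr => z _ do rewrite wparam_a /update eqxx.
under [X in _ = X * _ * _]eq_bigr => z _ do rewrite hornerM !hornerE.
under [X in _ = _ * _ * X]eq_bigr => z _ do rewrite !hornerE.
rewrite mulrAC mulrA; congr (_ * _ * _ * _).
by apply: eq_bigr => z _; rewrite /acoef; ring.
Qed.

Lemma horner_linear (a b t : F) : (a%:P - b *: 'X).[t] = a - b * t.
Proof. by rewrite !hornerE. Qed.

Lemma IzerginKorepin H V u v s x0 (n : nat) : size H = n -> size V = n ->
  generic H u -> uniq (map v V) ->
  {in H & V, forall h x, abcoef (u h) (v x) != 0} -> dwbc_state H V s ->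
  Z6 (wparam u v) H V s * (vdm (map u H) * vdm (map v V)) =
  (\prod_(h <- H) (1 + u h ^+ 2)) * (\prod_(h <- H) \prod_(x <- V) abcoef (u h) (v x)) *
  \det (IKmatrix H V u v n x0).
Proof.
elim: n H V u v s => [|n IHn] H V u v s sizeH sizeV genH uV abn dw.
  by move/size0nil: sizeH => ->; move/size0nil: sizeV => ->; rewrite /Z6 /= !big_nil det_mx00 !mulr1 /delta; case: eqP => // /eqP/negP[]; apply/eqP/ffunP=> l; rewrite ffunE.
case: V sizeV uV abn dw => // x V [sizeV] uV abn dw.
set Y := fun k => grid (wparam u v) H V (delta F (dwbc_flip H (x :: V) s)) (flip2 (nth x H k) x s).
set Z := Z6poly H x u Y.
have ZE t : Z6 (wparam u (update v x t)) H (x :: V) s = Z.[t] by rewrite Z6_update.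
pose Q k t := \prod_(h <- remove_nth k H) abcoef (u h) t.
pose minor k := \det (IKmatrix (remove_nth k H) V u v n x0).
pose C := (\prod_(h <- H) (1 + u h ^+ 2)) * (\prod_(h <- H) \prod_(y <- V) abcoef (u h) (v y)).
pose pab (h : S) : {poly F} := ((1 - u h)%:P - (1 + u h) *: 'X) * (1%:P - u h *: 'X).
have pabE h t : (pab h).[t] = abcoef (u h) t.
  by rewrite /pab hornerM !horner_linear /abcoef /acoef; ring.
pose P1 := (vdm (map u H) * vdm (map v V)) *: (Z * \prod_(y <- V) ('X - (v y)%:P)).
(* This is the expansion of the determinant along its first row, with the denominators of that row
   cleared; hence it is a polynomial. *)
pose P2 := C *: \sum_(k < n.+1) ((-1) ^+ k * minor k) *: \prod_(h <- remove_nth k H) pab h.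
have P2E t : P2.[t] = C * \sum_(k < n.+1) (-1) ^+ k * minor k * Q k t.
  rewrite /P2 hornerZ horner_sum; congr (_ * _); apply: eq_bigr => k _.
  by rewrite hornerZ horner_prod; congr (_ * _); apply: eq_bigr => h _.
have P1E t : P1.[t] = Z.[t] * (vdm (map u H) * (\prod_(y <- V) (t - v y) * vdm (map v V))).
  rewrite /P1 hornerZ hornerM horner_prod; under eq_bigr => y _ do rewrite hornerXsubC.
  by ring.
have P2det t : {in H, forall h, abcoef (u h) t != 0} ->
    P2.[t] = C * (\prod_(h <- H) abcoef (u h) t) *
       \det (\matrix_(j < n.+1, i < n.+1) (abcoef (u (nth x0 H i)) (nth 0 (t :: map v V) j))^-1).
  move=> abt; rewrite P2E -mulrA; congr (_ * _); rewrite expand_first_row big_distrr /=.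
  apply: eq_bigr => k _; have kH : (k < size H)%N by rewrite sizeH.
  rewrite !mxE /= (perm_big _ (perm_remove_nth x0 kH)) big_cons /= -/(Q k t).
  have -> : minor k = \det (\matrix_(i, j)
     (\matrix_(j, i) (abcoef (u (nth x0 H i)) (nth 0 (t :: map v V) j))^-1) (lift 0 i) (lift k j) : 'M[F]_n).
    congr (\det _); apply/matrixP=> i j; rewrite !mxE nth_remove_nth //= (nth_map x0) //.
    by rewrite sizeV add0n.
  have := abt _ (mem_nth x0 kH); move: (\det _) (abcoef _ _) => d c c0.
  by apply: (mulfI c0); field; rewrite c0.
have gen1 t : t \in [seq (u h)^-1 | h <- H] -> P1.[t] = P2.[t].
  case/mapP=> h /(nthP x0)[k kH <-] ->.
  set u0 := u _; set H' := remove_nth k H.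
  have permH := perm_remove_nth x0 kH; rewrite -/H' in permH.
  have u00 : u0 != 0 by case: genH => _ + _; apply; exact: mem_nth.
  have dw' : dwbc_state (nth x0 H k :: H') (x :: V) s.
    case: dw => un sH sV; split=> // [|l lH]; last by apply: sH; rewrite (perm_mem permH).
    by apply: etrans un; apply: perm_uniq; rewrite perm_cat2r perm_sym.
  have [dw'' _] := dwbc_state_behead dw'.
  have sub' : {subset H' <= H} by move=> l lH; rewrite (perm_mem permH) inE lH orbT.
  have sizeH' : size H' = n by rewrite size_remove_nth // sizeH.
  have uH' : uniq (map u H') /\ {in H', forall z, u z != u0}.
    case: genH => + _ _; rewrite (perm_uniq (perm_map u permH)) /= -/u0 => /andP[u0H ->].
    by split=> // z zH'; apply: contraNneq u0H => <-; apply: map_f.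
  have genH' : generic H' u.
    case: genH => _ nz gen; split=> [|z /sub'|z z' /sub' zH /sub' z'H]; [exact: uH'.1|exact: nz|exact: gen].
  have IH := IHn H' V u v _ sizeH' sizeV genH' _ _ dw''.
  have {}IH := IH (ltac:(by case/andP: uV)) (ltac:(by move=> a b /sub' aH bV; apply: abn; rewrite // inE bV orbT)).
  rewrite P1E -ZE (Z6_remove_nth _ x0 kH) //.
  rewrite Z6_frozen //; last by rewrite wparam_b /update eqxx mulfV // subrr mulr0.
  have -> : Z6 (wparam u (update v x u0^-1)) H' V (flip2 (nth x0 H k) x s) =
            Z6 (wparam u v) H' V (flip2 (nth x0 H k) x s).
    by rewrite /Z6 grid_update //; case: dw => + _ _; rewrite cat_uniq => /and3P[_ _ /andP[]].
  have kn : (k < n.+1)%N by rewrite -sizeH.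
  rewrite wparam_c -/u0 P2E (bigD1 (Ordinal kn)) //=.
  (* In every other term the product still runs over this row and contains [abcoef u0 u0^-1 = 0]. *)
  rewrite [X in _ = C * (_ + X)]big1 ?addr0 => [|i /eqP ik]; last first.
    have iH : (i < size H)%N by rewrite sizeH.
    have hk : nth x0 H k \in remove_nth i H.
      have := mem_nth x0 kH; rewrite (perm_mem (perm_remove_nth x0 iH)) inE => /orP[|//].
      case: dw => + _ _; rewrite cat_uniq => /and3P[uH _ _].
      rewrite nth_uniq // => /eqP ki; case: ik; apply: val_inj; exact: esym.
    rewrite [Q _ _](_ : _ = 0) ?mulr0 //; apply/eqP; rewrite prodf_seq_eq0; apply/hasP.
    by exists (nth x0 H k); rewrite //= -/u0 /abcoef mulfV // subrr mulr0.
  rewrite (vdm_remove_nth (k := k)) ?size_map // (nth_map x0) // -/u0 /remove_nth -map_remove_nth.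
  rewrite /C !(perm_big _ permH) !big_cons /= -/u0 -/H' /Q -/H'.
  have prodc (c : F) (l : seq S) (f : S -> F) : \prod_(z <- l) (c * f z) = c ^+ size l * \prod_(z <- l) f z.
    by elim: l => [|z l IHl]; rewrite ?big_nil ?mul1r // !big_cons IHl exprS mulrACA.
  have Hu (z : S) : u0 - u z = u0 * (1 - u z * u0^-1) by field.
  have Hv (z : S) : 1 - u0 * v z = u0 * (u0^-1 - v z) by field.
  have -> : \prod_(z <- V) abcoef u0 (v z) = (\prod_(z <- V) acoef u0 (v z)) * (u0 ^+ n * \prod_(z <- V) (u0^-1 - v z)).
    by rewrite -[in u0 ^+ n]sizeV -prodc -big_split; apply: eq_bigr => z _; rewrite -Hv.
  rewrite big_map.
  have xV : x \notin V by case: dw => + _ _; rewrite cat_uniq => /and3P[_ _ /andP[]].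
  rewrite [X in _ * X * _ * _ * _ = _](_ : _ = \prod_(z <- H') acoef (u z) u0^-1); last first.
    by apply: eq_bigr => z _; rewrite /acoef /update eqxx; ring.
  rewrite [X in _ * X * _ * _ = _](_ : _ = \prod_(z <- V) acoef u0 (v z)); last first.
    apply: eq_big_seq => z zV; rewrite /acoef /update ifN; first by ring.
    by apply: contraNneq xV => <-.
  rewrite [X in _ * (_ * (X * _) * _) = _](_ : _ = u0 ^+ n * \prod_(z <- H') (1 - u z * u0^-1)); last first.
    by rewrite -[in u0 ^+ n]sizeH' -prodc; apply: eq_bigr => z _.
  rewrite [X in _ = _ * (_ * _ * X)]big_split /=.
  move: IH; rewrite -[\det _]/(minor k); move: (minor k) (Z6 _ _ _ _) => c1 c2.
  move: (vdm _) (vdm _) => c3 c4.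
  move: (\prod_(j <- H') (1 + u j ^+ 2)) (\prod_(j <- H') \prod_(y <- V) _) => c5 c6.
  move: (\prod_(i <- H') acoef _ _) (\prod_(z <- V) acoef _ _) => c7 c8.
  move: (\prod_(i <- H') _) (\prod_(i <- V) _) (u0 ^+ n) ((-1) ^+ k) (1 + u0 ^+ 2) => c9 c10 c11 c12 c13 IH.
  by apply: (eq_from_combination (x := c13 * c7 * c8 * c12 * c11 * c9 * c10) (y := 0) (z := 0) IH IH IH); ring.
have gen2 t : t \in map v V -> P1.[t] = P2.[t].
  move=> tV; rewrite P1E (_ : \prod_(y <- V) (t - v y) = 0) ?mul0r ?mulr0; last first.
    apply/eqP; rewrite prodf_seq_eq0; apply/hasP; case/mapP: tV => y yV ->.
    by exists y; rewrite //= subrr.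
  rewrite P2det; last by move=> h hH; case/mapP: tV => y yV ->; apply: abn; rewrite // inE yV orbT.
  have jn : (index t (map v V) < n)%N by rewrite -sizeV -(size_map v) index_mem.
  rewrite (determinant_alternate (i1 := 0) (i2 := lift 0 (Ordinal jn))) ?mulr0 // => i.
  by rewrite !mxE /= nth_index.
have P12 : P1 = P2.
  apply/eqP; rewrite -subr_eq0; apply/negPn/negP => P0.
  pose rs := [seq (u h)^-1 | h <- H] ++ map v V.
  have := max_poly_roots (rs := rs) P0.
  have -> : all (root (P1 - P2)) rs.
    apply/allP=> t; rewrite mem_cat => /orP[/gen1|/gen2] e;
      by rewrite rootE hornerD hornerN e subrr.
  have -> : uniq rs.
    rewrite cat_uniq (map_comp GRing.inv u) map_inj_uniq; last exact: invr_inj.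
    case: genH => -> unz _; move: uV; rewrite map_cons cons_uniq => /andP[_ ->]; rewrite andbT.
    apply/hasPn=> t /mapP[y yV ->]; apply/negP => /mapP[a /mapP[h hH ->]] e.
    have := abn h y hH; rewrite inE yV orbT e => /(_ isT).
    by rewrite /abcoef mulfV ?subrr ?mulr0 ?eqxx // unz.
  move=> /(_ isT isT); rewrite size_cat !size_map sizeH sizeV ltnNge => /negP; apply.
  have sP : (size (\prod_(y <- V) ('X - (v y)%:P))%R <= n.+1)%N.
    by rewrite -sizeV; apply: size_prod_linear => y; rewrite size_XsubC.
  apply: (leq_trans (size_polyD _ _)); rewrite size_polyN geq_max addSn; apply/andP; split.
    apply: (leq_trans (size_scale_leq _ _)); apply: size_mul_leq sP.
    by rewrite -sizeH; exact: size_Z6poly.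
  apply: (leq_trans (size_scale_leq _ _)); apply: (leq_trans (size_sum _ _ _)).
  apply/bigmax_leqP => k _; apply: (leq_trans (size_scale_leq _ _)).
  have sk : size (remove_nth k H) = n by rewrite size_remove_nth ?sizeH.
  rewrite [X in (_ <= X)%N](_ : _ = (size (remove_nth k H) + size (remove_nth k H)).+1); last by rewrite sk.
  apply: size_prod_quadratic => h; apply: (@size_mul_leq _ _ 1 1); exact: size_linear_poly.
have upd : update v x (v x) = v.
  by apply: functional_extensionality => l; rewrite /update; case: eqP => [->|].
have := P1E (v x); rewrite P12 -ZE upd P2det => [|h hH]; last by apply: abn; rewrite // mem_head.
rewrite /= big_map => <-.
rewrite /C -!mulrA; congr (_ * _); rewrite mulrA; congr (_ * _).
  by rewrite -big_split; apply: eq_bigr => h _; rewrite big_cons mulrC.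
congr (\det _); apply/matrixP=> j i; rewrite !mxE; congr (abcoef _ _)^-1.
by rewrite -map_cons (nth_map x0) //= sizeV.
Qed.
End IzerginKorepin.

(** * The path kernel *)

(** The number of paths from [(x, y)] to [(0, y + d)] whose last step is not
    [(0, 1)]. *)
Fixpoint npaths (x : nat) : nat -> nat :=
  if x is x'.+1 then
    fix up d := if d is d'.+1 then (npaths x' d + npaths x' d' + up d')%N else 1%N
  else fun d => (d == 0%N).

Lemma npathsS x d : npaths x.+1 d.+1 = (npaths x d.+1 + npaths x d + npaths x.+1 d)%N.
Proof. by []. Qed.

Lemma npaths0 x : npaths x 0 = 1%N.
Proof. by case: x. Qed.

Arguments npaths : simpl never.

Section GeneratingFunction.
Variables (R : comPzRingType) (u v : R).

Let c k L := \sum_(l < L) (npaths k l.+1)%:R * v ^+ l : R.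

(** For the full series [f k = 1 + v * c k], the recursion on steps reads
    [(1 - v) * f k.+1 = (1 + v) * f k]. The last term here is the effect of truncation. *)
Let c_rec k L : (1 - v) * c k.+1 L =
  2 + (1 + v) * c k L - v ^+ L * (npaths k L + npaths k.+1 L)%:R.
Proof.
elim: L => [|L IHL]; first by rewrite /c !big_ord0 !npaths0 expr0; ring.
have c_S j : c j L.+1 = c j L + (npaths j L.+1)%:R * v ^+ L by rewrite /c big_ord_recr.
rewrite !c_S mulrDr IHL mulrDr exprS.
move: (npaths k L) (npaths k L.+1) (npaths k.+1 L) (npaths k.+1 L.+1) (npathsS k L) => x y z w ->.
by ring.
Qed.

Let T2 M L := \sum_(k < M) c k L * u ^+ k.

Let T2_rec M L : exists E, (1 - u - v - u * v) * T2 M.+1 L =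
  2 * (\sum_(k < M) u ^+ k.+1) - (1 + v) * c M L * u ^+ M.+1 + v ^+ L * E.
Proof.
elim: M => [|M [E IHM]].
  exists 0; rewrite /T2 big_ord_recl !big_ord0 /c big1 ?mulr0 ?mul0r; first by ring.
  by move=> i _; rewrite mul0r.
exists (E - (npaths M L + npaths M.+1 L)%:R * u ^+ M.+1).
rewrite /T2 big_ord_recr -/(T2 M.+1 L) mulrDr IHM [in RHS]big_ord_recr /=.
have e := c_rec M L; move: (\sum_(i < M) _) e => s e.
by apply: (eq_from_combination (x := u ^+ M.+1) (y := 0) (z := 0) e e e); rewrite !exprS; ring.
Qed.

(** The entries of [1 + M], where [M] counts the paths of [T4]. *)
Definition kernel (k l : nat) : R := (k == l)%:R + (npaths k l.+1)%:R.

(** The generating function of [kernel] is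
    [(1 + u^2) (1 - v) / ((1 - u) (1 - u - v - u v) (1 - u v))]. *)
Lemma kernel_truncation N : exists E1 E2 E3,
  (1 - u) * ((1 - u - v - u * v) * (1 - u * v)) *
     (\sum_(k < N.+1) \sum_(l < N.+1) kernel k l * u ^+ k * v ^+ l) =
  (1 + u ^+ 2) * (1 - v) + u ^+ N.+1 * E1 + v ^+ N.+1 * E2 + (u * v) ^+ N.+1 * E3.
Proof.
have -> : \sum_(k < N.+1) \sum_(l < N.+1) kernel k l * u ^+ k * v ^+ l =
          \sum_(k < N.+1) (u * v) ^+ k + T2 N.+1 N.+1.
  rewrite -big_split; apply: eq_bigr => k _ /=; rewrite /c big_distrl /=.
  under eq_bigr => l _ do rewrite !mulrDl.
  rewrite big_split /=; congr (_ + _); last by apply: eq_bigr => l _; ring.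
  rewrite (bigD1 k) //= eqxx big1 ?addr0 ?mul1r ?exprMn // => l /negPf lk.
  by rewrite eq_sym [_ == _ :> nat](_ : _ = false) ?mul0r.
have g1 (z : R) : (1 - z) * (\sum_(k < N.+1) z ^+ k) = 1 - z ^+ N.+1.
  by rewrite -opprB mulNr -subrX1 opprB.
have [E e2] := T2_rec N N.+1.
have e1 := g1 (u * v).
have e3 : (1 - u) * (\sum_(k < N) u ^+ k.+1) = u - u ^+ N.+1.
  have := g1 u; rewrite big_ord_recl expr0 => e.
  by apply: (eq_from_combination (x := 1) (y := 0) (z := 0) e e e); rewrite /=; ring.
exists (- 2 * (1 - u * v) - (1 - u * v) * (1 - u) * (1 + v) * c N N.+1).
exists ((1 - u) * (1 - u * v) * E), (- ((1 - u) * (1 - u - v - u * v))).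
move: (\sum_(k < N.+1) (u * v) ^+ k) (T2 _ _) (\sum_(k < N) _) (c _ _) e1 e2 e3 => s1 s2 s3 s4 e1 e2 e3.
apply: (eq_from_combination (x := (1 - u) * (1 - u - v - u * v))
  (y := (1 - u) * (1 - u * v)) (z := 2 * (1 - u * v)) e1 e2 e3); ring.
Qed.
End GeneratingFunction.

(** * Ring morphisms and auxiliary determinant identities *)

Definition map_weights (R R' : Type) (f : R -> R') (w : weights R) : weights R' :=
  Weights (f (wa w)) (f (wb w)) (f (wc w)) (f (wd w)).

Lemma Z6_rmorph (S : finType) (R R' : comPzRingType) (f : {rmorphism R -> R'})
    (w : S -> S -> weights R) (H V : seq S) (s : state S) :
  f (Z6 w H V s) = Z6 (fun y x => map_weights f (w y x)) H V s.
Proof.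
have lopf w0 i j (g : state S -> R) g' : (forall s, f (g s) = g' s) ->
    forall s, f (lop w0 i j g s) = lop (map_weights f w0) i j g' s.
  move=> gg' t; rewrite /lop; case: ifP => _; rewrite ?rmorphD !rmorphM ?gg' //.
  by case: (t i).
rewrite /Z6; set d := delta R _; set d' := delta R' _.
have : forall t, f (d t) = d' t by move=> t; rewrite rmorph_nat.
move: d d' => d d' dd'; elim: V s => //= x V IHV.
by elim: H {dd'} (grid _ H V d) (grid _ H V d') IHV => //= y H IHH g g' gg'; apply: lopf; exact: IHH.
Qed.

(** [vdm] takes its differences in the opposite order, which affects only the sign. Squares suffice
    because rows and columns receive the same nodes. *)
Lemma vdm_sq (R : comNzRingType) (f : nat -> R) (n : nat) :
  vdm [seq f i | i <- iota 0 n] ^+ 2 = \det (\matrix_(i < n, l < n) f i ^+ l) ^+ 2.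
Proof.
have vdmE m : vdm [seq f i | i <- iota m n] =
    \prod_(i < n) \prod_(j < n | (i < j)%N) (f (m + i)%N - f (m + j)%N).
  elim: n m => [|k IHk] m /=; first by rewrite big_ord0.
  rewrite big_ord_recl; congr (_ * _).
    rewrite [RHS]big_mkcond [RHS]big_ord_recl /= mul1r big_map -{1}[m.+1]addn0 iotaDl big_map.
    rewrite -{1}[k]subn0 -/(index_iota 0 k) big_mkord; apply: eq_bigr => i _.
    by rewrite /= addn0 addSnnS.
  rewrite IHk; apply: eq_bigr => i _; rewrite [RHS]big_mkcond [RHS]big_ord_recl /= mul1r [LHS]big_mkcond.
  by apply: eq_bigr => j _; rewrite /= !addSnnS.
have -> : \matrix_(i < n, l < n) f i ^+ l = (Vandermonde n (\row_i f i))^T.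
  by apply/matrixP=> i j; rewrite !mxE.
rewrite det_tr vdmE det_Vandermonde -!prodrXl; apply: eq_bigr => i _.
by rewrite -!prodrXl; apply: eq_bigr => j _; rewrite !mxE -sqrrN opprB.
Qed.

Lemma det_scale_rows_cols (R : comPzRingType) n (a b : 'I_n -> R) (M : 'M[R]_n) :
  \det (\matrix_(i, j) (a i * b j * M i j)) = (\prod_i a i) * (\prod_j b j) * \det M.
Proof.
have -> : \matrix_(i, j) (a i * b j * M i j) =
    diag_mx (\row_i a i) *m M *m diag_mx (\row_j b j).
  apply/matrixP=> i j; rewrite !mxE (bigD1 j) //= big1 => [|k kj]; last first.
    by rewrite !mxE (negPf kj) mulr0.
  rewrite addr0 !mxE eqxx mulr1n (bigD1 i) //= big1 => [|k ki]; last first.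
    by rewrite !mxE [i == k]eq_sym (negPf ki) mul0r.
  by rewrite !mxE eqxx mulr1n addr0 mulrAC.
rewrite !det_mulmx !det_diag mulrAC.
by congr (_ * _ * _); apply: eq_bigr => i _; rewrite mxE.
Qed.

(** Controls the truncation error: replacing the entries by truncated series changes the determinant
    only by a multiple of the same power of the indeterminate. *)
Lemma det_perturb (R : comPzRingType) n (x : R) (M E : 'M[R]_n) :
  exists g, \det (M + x *: E) = \det M + x * g.
Proof.
have prodE (I : finType) (F G : I -> R) :
    exists g, \prod_i (F i + x * G i) = \prod_i F i + x * g.
  rewrite unlock /=; elim: (index_enum I) => [|i l [g IH]] /=; first by exists 0; rewrite mulr0 addr0.
  exists (F i * g + G i * \big[*%R/1]_(i <- l) F i + G i * x * g).
  rewrite IH; rewrite unlock /=; ring.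
have sumE (I : finType) (A F G : I -> R) :
    (forall i, exists g, F i = G i + x * g) ->
    exists g, \sum_i A i * F i = \sum_i A i * G i + x * g.
  move=> FG; rewrite unlock /=; elim: (index_enum I) => [|i l [g IH]] /=; first by exists 0; rewrite mulr0 addr0.
  by have [h ->] := FG i; exists (A i * h + g); rewrite IH; ring.
apply: sumE => s; have [g e] := prodE _ (fun i => M i (s i)) (fun i => E i (s i)).
by exists g; rewrite -e; apply: eq_bigr => i _; rewrite !mxE.
Qed.

(** * The homogeneous limit *)

Section ConfluentLimit.
Variable K : numFieldType.

(** Distinct parameters that all vanish at [0], where the homogeneous limit is
    taken. *)
Definition node (i : nat) : {poly K} := i.+1%:R *: 'X.

Lemma node_eq i j : (node i == node j) = (i == j).
Proof.
apply/eqP/eqP => [|->] // /(congr1 (fun p : {poly K} => p`_1)).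
by rewrite !coefZ coefX !mulr1 => /eqP; rewrite eqr_nat eqSS => /eqP.
Qed.

Let C n m : 'M[K]_(n, m) := \matrix_(i, l) i.+1%:R ^+ l.

Let detC n : \det (C n n) != 0.
Proof.
have -> : C n n = (Vandermonde n (\row_i i.+1%:R))^T.
  by apply/matrixP=> i j; rewrite !mxE.
rewrite det_tr det_Vandermonde; apply/prodf_neq0 => i _; apply/prodf_neq0 => j ij.
by rewrite !mxE subr_eq0 eqr_nat eqSS neq_ltn ij orbT.
Qed.

Lemma det_nodes n : exists2 k : K, k != 0 & exists m,
  \det (\matrix_(i < n, l < n) node i ^+ l) = k *: 'X^m.
Proof.
exists (\det (C n n)); first exact: detC.
exists (\sum_(l < n) l)%N.
have -> : \matrix_(i < n, l < n) node i ^+ l =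
    \matrix_(i < n, l < n) (1 * 'X^l * (map_mx polyC (C n n)) i l).
  apply/matrixP=> i l; rewrite !mxE mul1r exprZn mulrC -mul_polyC; congr (_ * _).
rewrite det_scale_rows_cols big1 // mul1r -expr_sum det_map_mx mulrC mul_polyC.
by [].
Qed.

(** Column [k] of the rectangular Vandermonde matrix is homogeneous of degree [k], so the columns
    beyond the first [n] are combinations of these with coefficients divisible by ['X]. At 0 only
    the leading block of [G] survives. *)
Lemma confluent_det n N (G : 'M[K]_N) (nN : (n <= N)%N) : exists D : {poly K},
  \det (\matrix_(i < n, j < n) \sum_(k < N) \sum_(l < N) (G k l)%:P * node i ^+ k * node j ^+ l) =
    \det (\matrix_(i < n, l < n) node i ^+ l) ^+ 2 * D /\
  D.[0] = \det (\matrix_(i < n, j < n) G (widen_ord nN i) (widen_ord nN j)).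
Proof.
have Cunit : C n n \in unitmx by rewrite unitmxE unitfE detC.
have [Y CY Yn] : exists2 Y : 'M[K]_(n, N), C n n *m Y = C n N &
    forall l (k : 'I_N), (k < n)%N -> Y l k = (l == k :> nat)%:R.
  exists (invmx (C n n) *m C n N) => [|l k kn]; first by rewrite mulmxA mulmxV // mul1mx.
  have -> : (invmx (C n n) *m C n N) l k = (invmx (C n n) *m C n n) l (Ordinal kn).
    by rewrite !mxE; apply: eq_bigr => i _; rewrite !mxE.
  by rewrite mulVmx // !mxE.
(* For [k < l] the truncated exponent is 0; this is harmless, since then [k < n] and [Y l k = 0]. *)
pose W : 'M[{poly K}]_(n, N) := \matrix_(l, k) (Y l k *: 'X^(k - l)).
pose V := \matrix_(i < n, l < n) node i ^+ l.
have VW i k : (V *m W) i k = node i ^+ k.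
  transitivity ((C n n *m Y) i k *: 'X^k : {poly K}); last by rewrite CY mxE exprZn.
  rewrite !mxE scaler_suml; apply: eq_bigr => l _; rewrite !mxE exprZn.
  rewrite -scalerAl -scalerAr scalerA -exprD.
  case: (leqP l k) => [lk|kl]; first by rewrite subnKC.
  have kn : (k < n)%N := ltn_trans kl (ltn_ord l).
  by rewrite Yn // (gtn_eqF kl) mulr0 !scale0r.
(* The matrix is [V G' V^T] with [G' = W G W^T] and [V] the Vandermonde
   matrix of the nodes, which [VW] extends to [N] columns. *)
exists (\det (W *m map_mx polyC G *m W^T)); split.
  rewrite -/V expr2 -[X in _ * X * _]det_tr mulrAC -!det_mulmx; congr (\det _).
  rewrite !mulmxA -mulmxA -trmx_mul; apply/matrixP=> i j; rewrite [LHS]mxE [RHS]mxE.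
  rewrite exchange_big; apply: eq_bigr => l _; rewrite [_^T _ _]mxE VW [(_ *m _) _ _]mxE big_distrl /=.
  by apply: eq_bigr => k _; rewrite VW [in RHS]mxE [_%:P * _]mulrC.
rewrite -horner_evalE -det_map_mx; congr (\det _).
rewrite !map_mxM -map_trmx; apply/matrixP=> i j.
have W0 (a : 'I_n) (k : 'I_N) : (map_mx (horner_eval 0) W) a k = (a == k :> nat)%:R.
  rewrite !mxE /= /horner_eval hornerZ hornerXn expr0n subn_eq0.
  case: leqP => [ka|ak]; last by rewrite mulr0 (ltn_eqF ak).
  by rewrite mulr1 Yn // (leq_ltn_trans ka).
rewrite !mxE (bigD1 (widen_ord nN j)) //= big1 => [|k kj]; last first.
  rewrite [_^T _ _]mxE W0 [_ == _](_ : _ = false) ?mulr0 //.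
  by apply/negbTE; apply: contra kj => /eqP e; apply/eqP/val_inj.
rewrite [_^T _ _]mxE W0 eqxx mulr1 addr0 mxE (bigD1 (widen_ord nN i)) //= big1 => [|k ki]; last first.
  rewrite W0 [_ == _](_ : _ = false) ?mul0r //.
  by apply/negbTE; apply: contra ki => /eqP e; apply/eqP/val_inj.
by rewrite W0 eqxx mul1r addr0 !mxE /= /horner_eval hornerC.
Qed.
End ConfluentLimit.

(** * The determinant formula at the nodes and its value at 0 *)

Lemma map_wlines (R R' : comPzRingType) (f : {rmorphism R -> R'}) (r : R) (l l' : R * R) :
  map_weights f (wlines r l l') = wlines (f r) (f l.1, f l.2) (f l'.1, f l'.2).
Proof.
by rewrite /map_weights /wlines /= !(rmorphD, rmorphM, rmorphN, rmorphXn).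
Qed.

Lemma map_index (T : eqType) (T' : Type) (f : nat -> T') (l : seq T) : uniq l ->
  [seq f (index x l) | x <- l] = [seq f i | i <- iota 0 (size l)].
Proof.
move=> ul; rewrite (map_comp f (index^~ l)); congr map.
apply: (@eq_from_nth _ 0%N) => [|i]; rewrite size_map ?size_iota // => il.
case: l ul il => // x0 l ul il.
by rewrite (nth_map x0) // index_uniq // nth_iota.
Qed.

Section Homogeneous.
Variables (K : numFieldType) (r : K) (S : finType) (H V : seq S) (s : state S) (n : nat).
Hypotheses (rr : r * r = 2) (sizeH : size H = n) (sizeV : size V = n)
  (dw : dwbc_state H V s).

Let pu l : {poly K} := node K (index l H).
Let pv l : {poly K} := node K (index l V).
Let wp y x := wlines r%:P (1, - pu y) (- pv x, 1).
Let Zp := Z6 wp H V s.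

Let Zp0 : Zp.[0] = Z6 (fun _ _ => wsquare r) H V s.
Proof.
rewrite -horner_evalE Z6_rmorph; congr (Z6 _ _ _ _).
apply: functional_extensionality => y; apply: functional_extensionality => x.
rewrite map_wlines /wlines /wsquare /= /horner_eval /pu /pv /node !hornerE /=.
congr Weights; ring.
Qed.

Let kab (a b : {poly K}) := (1 - a - b - a * b) * (1 - a * b).

Let kab0 i j : (kab (node K i) (node K j)).[0] = 1.
Proof. by rewrite /kab /node !hornerE /=; ring. Qed.

Let U := [seq node K i | i <- iota 0 n].

Let uH : uniq H. Proof. by case: dw; rewrite cat_uniq => /and3P[]. Qed.
Let uV : uniq V. Proof. by case: dw; rewrite cat_uniq => /and3P[]. Qed.
Let mapu : map pu H = U.
Proof. by rewrite /U -sizeH -map_index. Qed.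
Let mapv : map pv V = U.
Proof. by rewrite /U -sizeV -map_index. Qed.

(** A common denominator of the Izergin-Korepin entries; the quotients [m i j] below give their
    matrix over [{poly K}]. *)
Let B := \prod_(i < n) \prod_(j < n) kab (node K i) (node K j).

Let cofactor_B (i j : 'I_n) : {m | kab (node K i) (node K j) * m = B}.
Proof.
exists ((\prod_(j' < n | j' != j) kab (node K i) (node K j')) *
  \prod_(i' < n | i' != i) \prod_(j' < n) kab (node K i') (node K j')).
transitivity ((\prod_(j' < n) kab (node K i) (node K j')) *
    \prod_(i' < n | i' != i) \prod_(j' < n) kab (node K i') (node K j')).
  by rewrite mulrA [in RHS](bigD1 j).
by rewrite /B [RHS](bigD1 i).
Qed.
Let m (i j : 'I_n) := sval (cofactor_B i j).
Let mE (i j : 'I_n) : kab (node K i) (node K j) * m i j = B := svalP (cofactor_B i j).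

Let phi : {rmorphism {poly K} -> {fraction {poly K}}} := @tofrac {poly K}.

Let phi_neq0 (p : {poly K}) : p.[0] = 1 -> phi p != 0.
Proof.
by move=> p0; rewrite tofrac_eq0; apply: contra_eqN p0 => /eqP->; rewrite horner0 eq_sym oner_eq0.
Qed.

Let phi_kab i j : abcoef (phi (node K i)) (phi (node K j)) = phi (kab (node K i) (node K j)).
Proof. by rewrite /abcoef /acoef /kab !(rmorphM, rmorphB, rmorph1). Qed.

(** The formula is applied in the fraction field, where the nodes are generic. One factor [B] for
    each row brings the determinant back to polynomials. *)
Let IK : (0 < n)%N -> Zp * vdm U ^+ 2 * B ^+ n =
  (\prod_(i < n) (1 + node K i ^+ 2)) * B * \det (\matrix_(j < n, i < n) m i j).
Proof.
move=> n0; have [x0 x0H] : exists x0, x0 \in H.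
  by case: H sizeH n0 => [<-|x0 H' _ _] //; exists x0; rewrite mem_head.
pose u y := phi (pu y); pose v y := phi (pv y).
have node_inj : injective (node K) by move=> i j /eqP; rewrite node_eq => /eqP.
have phi_inj : injective phi by move=> p q /eqP; rewrite tofrac_eq => /eqP.
have uniqU : uniq (map phi U).
  by rewrite map_inj_uniq // map_inj_uniq // iota_uniq.
have mapuE : map u H = map phi U by rewrite -mapu -map_comp.
have mapvE : map v V = map phi U by rewrite -mapv -map_comp.
have gen : generic H u.
  split=> [|h hH|h h' hH h'H]; first by rewrite mapuE.
    by rewrite tofrac_eq0 /pu /node scaler_eq0 polyX_eq0 orbF pnatr_eq0.
  rewrite -(rmorph1 phi) -rmorphM -!rmorphD -rmorphB; apply: phi_neq0.
  by rewrite /pu /node !hornerE /=; ring.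
have abn : {in H & V, forall h x, abcoef (u h) (v x) != 0}.
  by move=> h x _ _; rewrite /u /v phi_kab; apply: phi_neq0; exact: kab0.
have rr' : phi r%:P * phi r%:P = 2 by rewrite -rmorphM -polyCM rr !rmorph_nat.
have := IzerginKorepin rr' x0 sizeH sizeV gen _ abn dw; rewrite mapvE => /(_ uniqU).
have -> : Z6 (wparam (phi r%:P) u v) H V s = phi Zp.
  rewrite Z6_rmorph; congr (Z6 _ _ _ _).
  apply: functional_extensionality => y; apply: functional_extensionality => x.
  by rewrite map_wlines /wparam /= rmorph1 !rmorphN.
rewrite mapuE.
have -> : vdm (map phi U) = phi (vdm U).
  elim: U {uniqU mapuE mapvE} => [|x l IHl] /=; first by rewrite rmorph1.
  rewrite rmorphM rmorph_prod IHl big_map; congr (_ * _).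
  by apply: eq_bigr => y _; rewrite rmorphB.
have bigH (g : {fraction {poly K}} -> {fraction {poly K}}) :
    \prod_(h <- H) g (u h) = \prod_(i < n) g (phi (node K i)).
  rewrite -(big_map u predT) mapuE /U -map_comp big_map -{1}[n]subn0 -/(index_iota 0 n) big_mkord.
  by [].
have bigV (g : {fraction {poly K}} -> {fraction {poly K}}) :
    \prod_(h <- V) g (v h) = \prod_(i < n) g (phi (node K i)).
  rewrite -(big_map v predT) mapvE /U -map_comp big_map -{1}[n]subn0 -/(index_iota 0 n) big_mkord.
  by [].
rewrite (bigH (fun t => 1 + t ^+ 2)) (bigH (fun t => \prod_(x <- V) abcoef t (v x))).
under [X in _ = _ * X * _]eq_bigr => i _ do rewrite (bigV (abcoef _)).
have -> : \prod_(i < n) \prod_(j < n) abcoef (phi (node K i)) (phi (node K j)) = phi B.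
  by rewrite !rmorph_prod; apply: eq_bigr => i _; rewrite rmorph_prod; apply: eq_bigr => j _; rewrite phi_kab.
have -> : \prod_(i < n) (1 + phi (node K i) ^+ 2) = phi (\prod_(i < n) (1 + node K i ^+ 2)).
  by rewrite rmorph_prod; apply: eq_bigr => i _; rewrite rmorphD rmorph1 rmorphXn.
have : phi B ^+ n * \det (IKmatrix H V u v n x0) = phi (\det (\matrix_(j < n, i < n) m i j)).
  rewrite -detZ -det_map_mx; congr (\det _); apply/matrixP=> j i; rewrite !mxE.
  rewrite /u /v /pu /pv !index_uniq ?sizeH ?sizeV // phi_kab -(mE i j) rmorphM mulrC mulKf //.
  by apply: phi_neq0; exact: kab0.
move: (\det (IKmatrix _ _ _ _ _ _)) => d e1 e2; apply: phi_inj.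
rewrite !rmorphM !rmorphXn -e1; move: e2.
move: (phi Zp) (phi (vdm U)) (phi B) (phi _) => c1 c2 c3 c4 e2.
by apply: (eq_from_combination (x := c3 ^+ n) (y := 0) (z := 0) e2 e2 e2); ring.
Qed.

(** Up to a row and a column factor, the Izergin-Korepin entry is the generating function of
    [kernel]. The error is divisible by ['X^(M.+1)] because every node is a multiple of ['X]. The
    factor [1] matches the shape of [det_scale_rows_cols]. *)
Let trunc (M : nat) : exists e : 'I_n -> 'I_n -> {poly K}, forall i j : 'I_n,
  (1 - node K j) * (1 + node K i ^+ 2) * m i j + 'X^(M.+1) * e i j =
  1 * (B * (1 - node K i)) * (\sum_(k < M.+1) \sum_(l < M.+1)
      (kernel K k l)%:P * node K i ^+ k * node K j ^+ l).
Proof.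
suff cell (i j : 'I_n) : exists e,
    (1 - node K j) * (1 + node K i ^+ 2) * m i j + 'X^(M.+1) * e =
    1 * (B * (1 - node K i)) * (\sum_(k < M.+1) \sum_(l < M.+1)
      (kernel K k l)%:P * node K i ^+ k * node K j ^+ l).
  have /fin_all_exists[e eE] i := fin_all_exists (cell i).
  by exists e.
have [E1 [E2 [E3 e]]] := kernel_truncation (node K i) (node K j) M.
pose a : {poly K} := (i.+1%:R)%:P; pose b : {poly K} := (j.+1%:R)%:P.
have ea : node K i = a * 'X by rewrite mul_polyC.
have eb : node K j = b * 'X by rewrite mul_polyC.
have kE k l : kernel {poly K} k l = (kernel K k l)%:P by rewrite /kernel polyCD !polyC_natr.
move: e; under eq_bigr => k _ do under eq_bigr => l _ do rewrite kE.
move: (\sum_(k < M.+1) _) => s0.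
have -> : node K i ^+ M.+1 = a ^+ M.+1 * 'X^(M.+1) by rewrite ea exprMn.
have -> : node K j ^+ M.+1 = b ^+ M.+1 * 'X^(M.+1) by rewrite eb exprMn.
have -> : (node K i * node K j) ^+ M.+1 = (a * b) ^+ M.+1 * 'X^(M.+1) * 'X^(M.+1).
  by rewrite ea eb mulrACA exprMn [('X * 'X) ^+ _]exprMn mulrA.
move=> e; exists (m i j * (a ^+ M.+1 * E1 + b ^+ M.+1 * E2 + (a * b) ^+ M.+1 * 'X^(M.+1) * E3)).
rewrite -(mE i j) /kab; move: (node K i) (node K j) (m i j) e => u v mm e.
move: ('X^(M.+1)) (a ^+ M.+1) (b ^+ M.+1) ((a * b) ^+ M.+1) e => x1 x2 x3 x4 e.
by apply: (eq_from_combination (x := - mm) (y := 0) (z := 0) e e e); ring.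
Qed.

Lemma Z6_homogeneous_pos : (0 < n)%N ->
  Z6 (fun _ _ => wsquare r) H V s = \det (\matrix_(i < n, j < n) kernel K i j).
Proof.
move=> n0; have e1 := IK n0; rewrite -Zp0.
have [k k0 [d eV]] := det_nodes K n.
(* The squared Vandermonde determinant has order [2 d] in ['X]. The truncation goes beyond it, so
   that the error still vanishes at 0 after division, and it covers the leading block of size
   [n]. *)
pose M := (n + d.*2)%N; have [e2 e2E] := trunc M.
have nM : (n <= M.+1)%N by rewrite /M; lia.
have [D [e3 D0]] := confluent_det (\matrix_(k < M.+1, l < M.+1) kernel K k l) nM.
have {}D0 : D.[0] = \det (\matrix_(i < n, j < n) kernel K i j).
  by rewrite D0; congr (\det _); apply/matrixP=> i j; rewrite !mxE.
rewrite -D0; pose A := \matrix_(j < n, i < n) ((1 - node K j) * (1 + node K i ^+ 2) * m i j).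
have [g] := det_perturb 'X^(M.+1) A (\matrix_(j, i) e2 i j).
have -> : A + 'X^(M.+1) *: \matrix_(j, i) e2 i j = \matrix_(j, i) (1 * (B * (1 - node K i)) *
   (\matrix_(i < n, j < n) \sum_(k < M.+1) \sum_(l < M.+1)
      ((\matrix_(k < M.+1, l < M.+1) kernel K k l) k l)%:P * node K i ^+ k * node K j ^+ l)^T j i).
  apply/matrixP=> j i; rewrite !mxE e2E; congr (_ * _).
  by apply: eq_bigr => a _; apply: eq_bigr => b _; rewrite mxE.
have -> : \det A = (\prod_(j < n) (1 - node K j)) * (\prod_(i < n) (1 + node K i ^+ 2)) *
    \det (\matrix_(j < n, i < n) m i j).
  by rewrite -det_scale_rows_cols; congr (\det _); apply/matrixP=> j i; rewrite !mxE.
rewrite det_scale_rows_cols det_tr e3 eV.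
have -> : \prod_(i < n) (B * (1 - node K i)) = B ^+ n * \prod_(i < n) (1 - node K i).
  by rewrite big_split /= prodr_const card_ord.
rewrite big1 // mul1r.
have P0 : (\prod_(i < n) (1 - node K i)).[0] = 1.
  by rewrite horner_prod big1 // => i _; rewrite /node !hornerE /=; ring.
have B0 : B.[0] = 1.
  by rewrite /B horner_prod big1 // => i _; rewrite horner_prod big1 // => j _; exact: kab0.
move: e1; rewrite vdm_sq eV.
move: (\det _) (\prod_(i < n) (1 + _)) (\prod_(i < n) (1 - _)) P0 B B0 => dm NN P P0 BB B0 e1 e4.
have {}eX : (k *: 'X^d) ^+ 2 = (k ^+ 2)%:P * 'X^(d.*2) :> {poly K}.
  by rewrite exprZn -exprM muln2 mul_polyC.
have {}eM : 'X^(M.+1) = 'X^(d.*2) * 'X^(n.+1) :> {poly K}.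
  by rewrite -exprD; congr (_ ^+ _); rewrite /M; lia.
rewrite eX in e1 e4; rewrite eM in e4.
have : 'X^(d.*2) * (Zp * (k ^+ 2)%:P * BB ^+ n * P) =
       'X^(d.*2) * (BB * (BB ^+ n * P * (k ^+ 2)%:P * D - 'X^(n.+1) * g)).
  by apply: (eq_from_combination (x := P) (y := - BB) (z := 0) e1 e4 e4); ring.
move=> /(mulfI _) -/(_ _); rewrite -size_poly_eq0 size_polyXn => /(_ isT).
move=> /(congr1 (horner^~ 0)); rewrite !hornerE /=.
rewrite B0 P0 !expr1n exprS mul0r mul0r subr0 !mulr1 !mul1r => e.
by apply: (mulfI k0); apply: (mulfI k0); rewrite !mulrA -e; ring.
Qed.

End Homogeneous.

Theorem Z6_homogeneous (K : numFieldType) (r : K) (S : finType) (H V : seq S) (s : state S) (n : nat) :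
  r * r = 2 -> size H = n -> size V = n -> dwbc_state H V s ->
  Z6 (fun _ _ => wsquare r) H V s = \det (\matrix_(i < n, j < n) kernel K i j).
Proof.
case: n => [rr /size0nil-> /size0nil-> dw|n rr sH sV dw].
  rewrite det_mx00 /Z6 /= /delta; case: eqP => // -[]; apply/ffunP=> l.
  by rewrite ffunE.
exact: Z6_homogeneous_pos.
Qed.

(** * Families of non-intersecting paths *)

(** The principal minor of [I] is written at full size, with identity rows outside [I], which avoids
    reindexing. *)
Lemma det_add_id (R : comPzRingType) (n : nat) (M : 'M[R]_n) :
  \det (1%:M + M) = \sum_(I : {set 'I_n}) \det (\matrix_(i, j) if i \in I then M i j else (i == j)%:R).
Proof.
rewrite /determinant exchange_big /=; apply: eq_bigr => s _.
rewrite -big_distrr /=; congr (_ * _).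
under eq_bigr => i _ do rewrite mxE addrC.
rewrite bigA_distr /=; apply: eq_bigr => I _; apply: eq_bigr => i _.
by rewrite !mxE.
Qed.

Lemma big_seq_sub (R : nmodType) (T : choiceType) (l : seq T) (F : T -> R) : uniq l ->
  \sum_(u : seq_sub l) F (val u) = \sum_(a <- l) F a.
Proof.
move=> ul; rewrite -[in RHS](val_seq_sub_enum ul) big_map; apply: perm_big.
apply: uniq_perm; rewrite ?index_enum_uniq ?undup_uniq // => u.
by rewrite mem_index_enum mem_seq_sub_enum.
Qed.

Section LatticePaths.
Variable n : nat.

Definition pos : Type := (nat * nat)%type.
Definition pt (a : pos) : point := (a.1%:Z, a.2%:Z).

(** This is [admissible] with a free starting point, as needed when paths lose their first steps. *)
Definition path_to (a : point) (t : nat) (s : seq lstep) : bool :=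
  (last a (path_vertices a s) == (0, t%:Z)) && (last 0 (map val s) != (0, 1)).

(** The number of lists [s] such that [path_to (pt a) t s]. *)
Definition npath_to (a : pos) (t : nat) : nat :=
  if (a.2 <= t)%N then npaths a.1 (t - a.2) else 0%N.

Lemma stepP (st : lstep) : [\/ val st = (-1, 0), val st = (0, 1) | val st = (-1, 1)].
Proof. by have := valP st; rewrite !inE => /or3P[] /eqP; constructor. Qed.

Lemma last_path_vertices (a : point) (s : seq lstep) :
  last a (path_vertices a s) = a + \sum_(st <- s) val st.
Proof.
elim: s a => [|st s IHs] a /=; first by rewrite big_nil addr0.
by rewrite big_cons addrA -IHs.
Qed.

Definition move (a : pos) (d : point) : pos :=
  if d == (-1, 0) then (a.1.-1, a.2)
  else if d == (0, 1) then (a.1, a.2.+1) else (a.1.-1, a.2.+1).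

Lemma pt_move (a : pos) (st : lstep) : (0 < a.1)%N -> pt (move a (val st)) = pt a + val st.
Proof.
case: a => x y /= x0; rewrite /move /pt.
have [] := stepP st => -> /=; apply/eqP; rewrite xpair_eqE /=; lia.
Qed.

Lemma npath_to_move (a : pos) t : (0 < a.1)%N ->
  npath_to a t = (npath_to (move a (-1, 0)%R) t + npath_to (move a (0, 1)%R) t +
                  npath_to (move a (-1, 1)%R) t)%N.
Proof.
case: a => [[//|x] y] _; rewrite /npath_to /move /=.
case: (ltngtP y t) => [yt|ty|->]; last 2 first.
- by [].
- by rewrite subnn !npaths0 ?ltnn.
have -> : (t - y = (t - y.+1).+1)%N by lia.
by rewrite npathsS; lia.
Qed.

Lemma big_lstep (R : nmodType) (F : point -> R) :
  \sum_(st : lstep) F (val st) = F (-1, 0) + F (0, 1) + F (-1, 1).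
Proof.
by rewrite (big_seq_sub F) // !big_cons big_nil addr0 addrA.
Qed.

(** A step to the left from column 0 can never be undone, and a path of vertical steps alone may not
    end. *)
Lemma path_to_stop (a : pos) t s : a.1 = 0%N -> path_to (pt a) t s = (s == [::]) && (a.2 == t).
Proof.
case: a => x y /= ->; apply/idP/idP => [|/andP[/eqP-> /eqP->]]; last first.
  by rewrite /path_to /= eqxx.
rewrite /path_to last_path_vertices => /andP[/eqP e l].
have ge0 (l0 : seq lstep) : (\sum_(st <- l0) val st).1 <= 0.
  elim: l0 => [|st l0]; rewrite ?big_nil ?big_cons //=.
  by case: (\sum_(_ <- l0) _) => p q; have [] := stepP st => -> /=; lia.
elim/last_ind: s e l => [|s st _]; first by rewrite big_nil addr0 => -[->] _; rewrite !eqxx.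
rewrite -cats1 big_cat big_seq1 /= map_cat last_cat; move: (ge0 s).
case: (\sum_(_ <- s) _) => p q /=; have [] := stepP st => -> //=.
- by move=> p0 [e _]; exfalso; move: e; lia.
- by move=> p0 [e _]; exfalso; move: e; lia.
Qed.

Lemma path_to_size (a : pos) t s : path_to (pt a) t s -> (size s + a.2 <= t + a.1)%N.
Proof.
case: a => x y; rewrite /path_to last_path_vertices => /andP[/eqP e _]; move: e.
suff: (size s)%:Z <= (\sum_(st <- s) val st).2 - (\sum_(st <- s) val st).1.
  by case: (\sum_(_ <- s) _) => p q /= h [e1 e2]; move: e1 e2 h; rewrite /pt /=; lia.
elim: s => [|st s]; rewrite ?big_nil ?big_cons //=.
by case: (\sum_(_ <- s) _) => p q /=; have [] := stepP st => -> /=; lia.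
Qed.

Lemma path_to_cons (a : pos) t st s : (0 < a.1)%N ->
  path_to (pt a) t (st :: s) = path_to (pt (move a (val st))) t s.
Proof.
move=> x0; rewrite pt_move // /path_to /=; case: s => [|st' s] //=.
(* Only the empty tail is left. A lone step [(0, 1)] breaks the condition on the last step on one
   side; on the other, the abscissa is still positive, so the end point is wrong. *)
have [] := stepP st => e; rewrite e //= andbF andbT.
by case: a x0 => x y /= x0; apply/esym/negbTE; rewrite xpair_eqE /=; lia.
Qed.

(** The order in which a sweep from right to left, and upwards in each column,
    meets the vertices. *)
Definition later (p q : point) : bool := (q.1 < p.1) || (q.1 == p.1) && (p.2 < q.2).

Lemma later_path (p a : point) s : later p a -> all (later p) (path_vertices a s).
Proof.
elim: s a => [|st s IHs] a pa /=; first by rewrite pa.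
rewrite pa /=; apply: IHs; move: pa; rewrite /later.
by case: p a => p1 p2 [a1 a2]; have [] := stepP st => -> /=; lia.
Qed.
End LatticePaths.

(** * Families of disjoint paths with arbitrary starts, and their determinant *)

Section Families.
Variables (n : nat) (I : {set 'I_n}).
Notation T := {i : 'I_n | i \in I}.
Implicit Types (a : 'I_n -> pos) (P : {ffun T -> lpath n}).

Definition verts a P (u : T) := path_vertices (pt (a (val u))) (P u).

Definition family a P : bool :=
  [forall u : T, path_to (pt (a (val u))) (val u).+1 (P u)] &&
  [forall u : T, forall v : T, (u != v) ==> ~~ has (mem (verts a P u)) (verts a P v)].

Definition reset a (k : 'I_n) (b : pos) : 'I_n -> pos := fun i => if i == k then b else a i.

Lemma family_cons a P P' (k : T) (st : lstep) : (0 < (a (val k)).1)%N ->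
  (forall u, u != k -> later (pt (a (val k))) (pt (a (val u)))) ->
  P k = st :: P' k :> seq lstep -> (forall u, u != k -> P u = P' u) ->
  family a P = family (reset a (val k) (move (a (val k)) (val st))) P'.
Proof.
move=> x0 lat Pk PP'; set a' := reset _ _ _.
have a'k : a' (val k) = move (a (val k)) (val st) by rewrite /a' /reset eqxx.
have a'N u : u != k -> a' (val u) = a (val u) by rewrite /a' /reset (inj_eq val_inj) => /negPf->.
have vN u : u != k -> verts a' P' u = verts a P u by move=> uk; rewrite /verts a'N // PP'.
have vk : verts a P k = pt (a (val k)) :: verts a' P' k.
  by rewrite /verts Pk a'k pt_move.
have notin u : u != k -> pt (a (val k)) \notin verts a P u.
  move=> uk; apply/negP => /(allP (later_path _ (lat u uk))).
  by rewrite /later !ltxx andbF.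
congr (_ && _).
  apply: eq_forallb => u; case: (eqVneq u k) => [->|uk]; last by rewrite a'N // PP'.
  by rewrite Pk path_to_cons // a'k.
apply: eq_forallb => u; apply: eq_forallb => v; case: (eqVneq u v) => [//|uv]; rewrite !implyTb.
case: (eqVneq u k) uv => [->|uk]; case: (eqVneq v k) => [->|vk'] //; rewrite ?eqxx // => _.
- rewrite (vN v) // vk; congr (~~ _).
  rewrite -!(has_sym (verts a P v)) [LHS]/= [X in X || _](_ : _ = false) //.
  exact/negbTE/notin.
- rewrite (vN u) // vk; congr (~~ _).
  by rewrite [LHS]/= (negPf (notin _ uk)).
- by rewrite !vN.
Qed.

(** The count for arbitrary starts, so that a recursion on first steps can be set up. *)
Definition nfamily a := #|[set P | family a P]|.

Lemma nfamily_move a (k : T) : (0 < (a (val k)).1 < n)%N ->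
  (forall u, u != k -> later (pt (a (val k))) (pt (a (val u)))) ->
  nfamily a = (\sum_(st : lstep) nfamily (reset a (val k) (move (a (val k)) (val st))))%N.
Proof.
move=> /andP[x0 xn] lat.
pose A := [set p : lstep * {ffun T -> lpath n} |
  family (reset a (val k) (move (a (val k)) (val p.1))) p.2].
have -> : (\sum_(st : lstep) nfamily (reset a (val k) (move (a (val k)) (val st))))%N = #|A|.
  rewrite -sum1_card (eq_bigl (fun p => predT p.1 && family (reset a (val k) (move (a (val k)) (val p.1))) p.2)); last by move=> p; rewrite inE.
  rewrite -(pair_big_dep predT (fun st P => family (reset a (val k) (move (a (val k)) (val st))) P) (fun _ _ => 1%N)).
  by apply: eq_bigr => st _; rewrite /nfamily -sum1_card; apply: eq_bigl => P; rewrite inE.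
pose consk (p : lstep * {ffun T -> lpath n}) : {ffun T -> lpath n} :=
  [ffun u => if u == k then insub_bseq n.*2 (p.1 :: p.2 k) else p.2 u].
have consN p u : u != k -> consk p u = p.2 u by rewrite ffunE => /negPf->.
have insubE (s : seq lstep) : (size s <= n.*2)%N -> insub_bseq n.*2 s = s :> seq lstep.
  by move=> ss; rewrite /insub_bseq insubdK.
have conskE p : p \in A -> consk p k = p.1 :: p.2 k :> seq lstep.
  rewrite inE => /andP[/forallP/(_ k) pk _]; rewrite ffunE eqxx insubE //.
  (* By [path_to_size] the lengthened path still fits the bound [2 n], so [insub_bseq] never returns
     its default here. *)
  move: pk; rewrite /reset eqxx -path_to_cons // => /path_to_size.
  by have := ltn_ord (val k); lia.
have famE p : p \in A -> family a (consk p).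
  move=> pA; rewrite (family_cons x0 lat (conskE p pA)); last exact: consN.
  by move: pA; rewrite inE.
transitivity #|consk @: A|; last first.
  apply: card_in_imset => p q pA qA pq.
  have := conskE p pA; rewrite pq conskE // => -[e1 e2].
  case: p q pA qA pq e1 e2 => [st P] [st' P'] _ _ pq /= <- e2; congr (_, _).
  apply/ffunP=> u; case: (eqVneq u k) => [->|uk]; first exact/val_inj.
  by have := congr1 (fun f : {ffun _} => f u) pq; rewrite !consN.
apply: eq_card => P; rewrite inE; apply/idP/imsetP => [fP|[p pA ->]]; last exact: famE.
case Pk: (P k : seq lstep) => [|st s].
  move: fP => /andP[/forallP/(_ k) + _]; rewrite Pk /path_to /= => /andP[/eqP[e _] _].
  by move: x0; rewrite -(ltz_nat 0) e.
have ss : (size s <= n.*2)%N by have := size_bseq (P k); rewrite Pk; exact: ltnW.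
pose P' : {ffun T -> lpath n} := [ffun u => if u == k then insub_bseq n.*2 s else P u].
have P'k : P k = st :: P' k :> seq lstep by rewrite Pk ffunE eqxx insubE.
have P'N u : u != k -> P u = P' u by rewrite ffunE => /negPf->.
have pA : (st, P') \in A by rewrite inE -(family_cons x0 lat P'k).
exists (st, P') => //; apply/ffunP=> u; case: (eqVneq u k) => [->|uk]; last by rewrite consN // P'N.
by apply/val_inj; rewrite [RHS]conskE.
Qed.

Variable R : comPzRingType.

Definition path_matrix a : 'M[R]_n :=
  \matrix_(i, j) if i \in I then (npath_to (a i) j.+1)%:R else (i == j)%:R.

Lemma det_path_matrix_move a (k : 'I_n) : k \in I -> (0 < (a k).1)%N ->
  \det (path_matrix a) =
  \sum_(st : lstep) \det (path_matrix (reset a k (move (a k) (val st)))).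
Proof.
move=> kI x0; rewrite (big_lstep (fun d => \det (path_matrix (reset a k (move (a k) d))))).
have cof b j : cofactor (path_matrix (reset a k b)) k j = cofactor (path_matrix a) k j.
  rewrite /cofactor; congr (_ * \det _); apply/matrixP=> i i'; rewrite !mxE /reset.
  by rewrite eq_sym (negPf (neq_lift _ _)).
rewrite !(expand_det_row _ k) -!big_split; apply: eq_bigr => j _ /=.
rewrite !cof -!mulrDl; congr (_ * _).
by rewrite !mxE kI /reset eqxx npath_to_move // !natrD.
Qed.

Lemma path_to_height (b : pos) t s : path_to (pt b) t s -> (b.2 <= t)%N.
Proof.
case: b => x y; rewrite /path_to last_path_vertices => /andP[/eqP e _]; move: e.
suff: 0 <= (\sum_(st <- s) val st).2.
  by case: (\sum_(_ <- s) _) => p q /= h [e1 e2]; move: e1 e2 h; rewrite /pt /=; lia.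
elim: s => [|st s]; rewrite ?big_nil ?big_cons //=.
by case: (\sum_(_ <- s) _) => p q /=; have [] := stepP st => -> /=; lia.
Qed.

Lemma det_row_eq0 (M : 'M[R]_n) k : (forall j, M k j = 0) -> \det M = 0.
Proof. by move=> M0; rewrite (expand_det_row _ k) big1 // => j _; rewrite M0 mul0r. Qed.

Lemma nfamily_eq0 a : (forall P, ~~ family a P) -> nfamily a = 0%N.
Proof. by move=> aP; apply/eqP; rewrite cards_eq0; apply/eqP/setP=> P; rewrite !inE (negPf (aP P)). Qed.

(** Each row in [I] is zero or a unit row given by the height. If all heights are correct, both
    sides are 1. Otherwise the least wrong index [k] produces a zero row, two equal rows or a zero
    column. *)
Lemma nfamily_stop a : {in I, forall k, (a k).1 = 0%N} ->
  {in I &, forall k l : 'I_n, (k < l)%N -> (a k).2 < (a l).2}%N ->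
  (nfamily a)%:R = \det (path_matrix a).
Proof.
move=> a0 amono.
have aE k : k \in I -> a k = (0%N, (a k).2) by move=> kI; rewrite -(a0 k kI); case: (a k).
have entry i j : i \in I -> path_matrix a i j = ((a i).2 == j.+1)%:R.
  move=> iI; rewrite mxE iI /npath_to a0 // /npaths; case: ltngtP => //.
    by move=> ij; rewrite subn_eq0 leqNgt ij.
  by move=> ->; rewrite subnn.
have [/forallP all1|] := boolP [forall k, (k \in I) ==> ((a k).2 == k.+1)].
  have aI k : k \in I -> (a k).2 = k.+1 by move=> kI; have := all1 k; rewrite kI => /eqP.
  have -> : path_matrix a = 1%:M.
    apply/matrixP=> i j; case: (boolP (i \in I)) => iI; last by rewrite !mxE (negPf iI).
    by rewrite entry // aI // mxE eqSS.
  rewrite det1 (_ : nfamily a = 1%N) //; apply/eqP/cards1P.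
  exists [ffun=> [bseq]]; apply/setP=> P; rewrite !inE; apply/idP/eqP => [|->].
    move=> /andP[/forallP fP _]; apply/ffunP=> u; rewrite ffunE; apply/val_inj.
    by have := fP u; rewrite path_to_stop ?a0 ?(valP u) // => /andP[/eqP].
  apply/andP; split; apply/forallP=> u.
    by rewrite ffunE path_to_stop ?a0 ?(valP u) // aI ?(valP u) // eqxx.
  apply/forallP=> v; apply/implyP=> uv; rewrite /verts !ffunE /= orbF inE.
  rewrite (aE _ (valP u)) (aE _ (valP v)) !aI ?(valP u) ?(valP v) //.
  apply: contra uv; rewrite /pt xpair_eqE /= => /eqP e; apply/eqP/val_inj/val_inj.
  by case: e.
rewrite negb_forall => /existsP[k0]; rewrite negb_imply => k0P.
rewrite nfamily_eq0 => [|P]; last first.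
  case/andP: k0P => k0I; apply: contra => /andP[/forallP/(_ (Sub k0 k0I)) + _].
  by rewrite path_to_stop ?a0 // => /andP[].
case: (@arg_minnP _ k0 (fun k => (k \in I) && ((a k).2 != k.+1)) val k0P) => k /andP[kI ak] kmin.
have akmin i : i \in I -> (i < k)%N -> (a i).2 = i.+1.
  move=> iI ik; apply/eqP/negPn/negP => ai; have := kmin i; rewrite iI ai => /(_ isT).
  by rewrite leqNgt ik.
case: (leqP 1 (a k).2) => [ak1|]; last first.
  rewrite ltnS leqn0 => /eqP ak0; rewrite mulr0n; apply/esym/(@det_row_eq0 _ k) => j.
  by rewrite entry // ak0.
case: (leqP (a k).2 n) => [akn|akn]; last first.
  rewrite mulr0n; apply/esym/(@det_row_eq0 _ k) => j; rewrite entry // gtn_eqF //.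
  exact: leq_ltn_trans (ltn_ord j) akn.
have jn : ((a k).2.-1 < n)%N by lia.
pose j := Ordinal jn; have ej : (a k).2 = j.+1 by rewrite /=; lia.
case: (ltngtP j k) => [jk|kj|jk].
(* Row [j] is the unit row of index [j] whether or not [j] belongs to [I], and row [k] repeats
   it. *)
- rewrite mulr0n; apply/esym/(@determinant_alternate _ _ _ j k) => [|i]; first by rewrite neq_ltn jk.
  rewrite [RHS]entry // ej eqSS; case: (boolP (j \in I)) => jI; last by rewrite !mxE (negPf jI).
  by rewrite entry // akmin // eqSS.
(* Column [k] is zero: the rows of [I] before [k] have their own unit, and those after [k] lie
   higher than row [k]. *)
- rewrite mulr0n; apply/esym; rewrite (expand_det_col _ k) big1 // => i _.
  case: (boolP (i \in I)) => iI; last first.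
    by rewrite !mxE (negPf iI) (_ : (i == k) = false) ?mul0r //; apply: contraNF iI => /eqP->.
  rewrite entry // (_ : (_ == _) = false) ?mul0r //; apply/negbTE.
  case: (ltngtP i k) => [ik|ki|/val_inj->]; last exact: ak.
    by rewrite akmin // eqSS neq_ltn ik.
  by have := amono k i kI iI ki; rewrite ej; lia.
- by rewrite ej jk eqxx in ak.
Qed.

(** The planarity condition of the lemma below. It survives a step of the first path in the sweep
    order, so paths that remain disjoint reach column 0 in the order of their indices. *)
Definition monotone_starts a := {in I, forall k, (a k).1 < n}%N /\
  {in I &, forall k l : 'I_n, (k < l)%N -> ((a k).1 <= (a l).1) && ((a k).2 <= (a l).2)}%N.

(** Both sides satisfy the same recursion on the first step of the path whose
    start comes first in the sweep order [later]: no other path can return to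
    that vertex. *)
Lemma lindstrom_gessel_viennot a : monotone_starts a -> (nfamily a)%:R = \det (path_matrix a).
Proof.
(* Each step lowers this sum. Heights above [n] are excluded at once, so the truncated subtraction
   really decreases. *)
have [m] := ubnP (\sum_(k in I) ((a k).1 + (n.+1 - (a k).2)))%N.
elim: m a => // m IHm a am [ax amono].
have [/existsP[k /andP[kI kn]]|] := boolP [exists k, (k \in I) && (n < (a k).2)%N].
  rewrite nfamily_eq0 => [|P]; last first.
    apply/negP=> /andP[/forallP/(_ (Sub k kI))/path_to_height + _]; rewrite SubK => h.
    by have := ltn_ord k; lia.
  apply/esym/(@det_row_eq0 _ k) => j; rewrite mxE kI /npath_to ifF //.
  by have := ltn_ord j; lia.
rewrite negb_exists => /forallP alow.
have {}alow k : k \in I -> ((a k).2 <= n)%N by move=> kI; have := alow k; rewrite kI -leqNgt.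
have [/existsP[k /existsP[l /and4P[kI lI kl /eqP akl]]]|] :=
  boolP [exists k, exists l, [&& k \in I, l \in I, k != l & a k == a l]].
  rewrite nfamily_eq0 => [|P]; last first.
    apply/negP=> /andP[_ /forallP/(_ (Sub k kI))/forallP/(_ (Sub l lI))].
    rewrite -(inj_eq val_inj) !SubK kl implyTb => /hasPn/(_ (pt (a k))).
    by rewrite /verts !SubK akl /= !mem_head => /(_ isT).
  apply/esym/(@determinant_alternate _ _ _ k l) => // j.
  by rewrite !mxE kI lI akl.
move=> anc; have {anc} anc k l : k \in I -> l \in I -> k != l -> a k != a l.
  move=> kI lI kl; apply: contraNneq anc => akl; apply/existsP; exists k; apply/existsP; exists l.
  by rewrite kI lI kl akl eqxx.
have {}anc k l : k \in I -> l \in I -> k != l -> ((a k).1 != (a l).1) || ((a k).2 != (a l).2).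
  by move=> kI lI kl; have := anc k l kI lI kl; rewrite -negb_and -xpair_eqE -!surjective_pairing.
have [/forallP a0|] := boolP [forall k, (k \in I) ==> ((a k).1 == 0%N)].
  have {}a0 : {in I, forall k, (a k).1 = 0%N} by move=> k kI; have := a0 k; rewrite kI => /eqP.
  apply: nfamily_stop => // k l kI lI kl.
  have kl' : k != l by rewrite neq_ltn kl.
  by have := anc k l kI lI kl'; have := amono k l kI lI kl; rewrite !a0 //; lia.
rewrite negb_forall => /existsP[k1]; rewrite negb_imply => /andP[k1I k1x].
(* The rank in the order [later]: columns from right to left, then heights, which are at most
   [n]. *)
pose key i := ((n - (a i).1) * n.+1 + (a i).2)%N.
case: (@arg_minnP _ k1 (mem I) key k1I) => k kI kmin.
have {}kmin i : i \in I -> i != k ->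
    ((a i).1 < (a k).1)%N || ((a i).1 == (a k).1) && ((a k).2 < (a i).2)%N.
  move=> iI ik; have := kmin i iI; rewrite /key.
  have := anc i k iI kI ik; have := alow i iI; have := alow k kI; have := ax i iI; have := ax k kI.
  nia.
have x0 : (0 < (a k).1)%N.
  case: (eqVneq k1 k) => [<-|k1k]; first by rewrite lt0n.
  by have := kmin k1 k1I k1k; move: k1x; lia.
rewrite (det_path_matrix_move kI x0) (@nfamily_move _ (Sub k kI)) /=; first last.
- move=> u uk; have := kmin (val u) (valP u); rewrite /later /= => /(_ uk); lia.
- by rewrite x0 ax.
rewrite natr_sum; apply: eq_bigr => st _; rewrite ltnS in am; apply: IHm.
  apply: leq_trans am; rewrite (bigD1 k) //= [in leqRHS](bigD1 k) //= -addSn.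
  apply: leq_add; last first.
    by apply: leq_sum => i /andP[_ ik]; rewrite /reset (negPf ik).
  rewrite /reset eqxx /move; have := alow k kI.
  by have [] := stepP st => -> /=; lia.
split=> [i iI|i l iI lI il]; rewrite /reset.
  case: (eqVneq i k) => _; last exact: ax.
  by have := ax k kI; rewrite /move; have [] := stepP st => -> /=; lia.
have := amono i l iI lI il.
case: (eqVneq i k) => [ik|ik]; case: (eqVneq l k) => [lk|lk] //.
- by move: il; rewrite ik lk ltnn.
- have := kmin l lI lk; have := ax k kI; rewrite /move ik; have [] := stepP st => -> /=; lia.
- have := kmin i iI ik; rewrite /move lk; have [] := stepP st => -> /=; lia.
Qed.
End Families.

Theorem T4_det (R : comPzRingType) (n : nat) :
  (T4 n)%:R = \det (\matrix_(i < n, j < n) kernel R i j).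
Proof.
have -> : \matrix_(i < n, j < n) kernel R i j =
    1%:M + \matrix_(i, j) (npaths i j.+1)%:R by apply/matrixP=> i j; rewrite !mxE.
rewrite det_add_id /T4 natr_sum; apply: eq_bigr => I _.
have mono : monotone_starts I (fun i : 'I_n => (nat_of_ord i, 0%N)).
  by split=> [i _|i j _ _ ij] //=; rewrite andbT; exact: ltnW.
transitivity ((@nfamily n I (fun i : 'I_n => (nat_of_ord i, 0%N)))%:R : R).
  congr (_%:R); apply: eq_card => P; rewrite !inE /disjoint_family /family.
rewrite lindstrom_gessel_viennot //; congr (\det _); apply/matrixP=> i j; rewrite !mxE.
by case: ifP.
Qed.

(** * Configurations as runs of a sweep of the grid *)

Definition bits : Type := (bool * bool * bool)%type.

Definition weight3 (b : bits) : nat := (b.1.1 + b.1.2 + b.2)%N.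

Definition set3 (S : finType) (i j k : S) (s : state S) (b : bits) : state S :=
  [ffun l => if l == i then b.1.1 else if l == j then b.1.2 else if l == k then b.2 else s l].

Definition get3 (S : finType) (i j k : S) (s : state S) : bits := (s i, s j, s k).

Lemma vertex20_sum (S : finType) (R : comPzRingType) (i j k : S) (f : state S -> R) s :
  i != j -> i != k -> j != k ->
  vertex20 i j k f s = \sum_(b : bits | weight3 (get3 i j k s) == weight3 b) f (set3 i j k s b).
Proof.
move=> ij ik jk.
have sum8 (F : bits -> R) : \sum_b F b = \sum_x \sum_y \sum_z F (x, y, z).
  by rewrite !pair_bigA; apply: eq_bigr => -[[x y] z].
have flip (p q : S) (b : bits) : (forall l, flip2 p q s l = set3 i j k s b l) ->
    flip2 p q s = set3 i j k s b by move=> h; apply/ffunP.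
have ji : j != i by rewrite eq_sym.
have ki : k != i by rewrite eq_sym.
have kj : k != j by rewrite eq_sym.
have E0 : s = set3 i j k s (s i, s j, s k).
  apply/ffunP=> l; rewrite ffunE /=.
  by case: (eqVneq l i) => [->|_] //; case: (eqVneq l j) => [->|_] //; case: (eqVneq l k) => [->|_].
have E1 : flip2 i j s = set3 i j k s (~~ s i, ~~ s j, s k).
  apply: flip => l; rewrite !ffunE /=.
  case: (eqVneq l i) => [->|_]; first by rewrite (negPf ij) /= ?addbT ?addbF.
  case: (eqVneq l j) => [->|_]; first by rewrite /= ?addbT ?addbF.
  by case: (eqVneq l k) => [->|_]; rewrite /= ?addbT ?addbF.
have E2 : flip2 i k s = set3 i j k s (~~ s i, s j, ~~ s k).
  apply: flip => l; rewrite !ffunE /=.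
  case: (eqVneq l i) => [->|_]; first by rewrite (negPf ik) /= ?addbT ?addbF.
  case: (eqVneq l j) => [->|_]; first by rewrite (negPf jk) /= ?addbT ?addbF.
  by case: (eqVneq l k) => [->|_]; rewrite /= ?addbT ?addbF.
have E3 : flip2 j k s = set3 i j k s (s i, ~~ s j, ~~ s k).
  apply: flip => l; rewrite !ffunE /=.
  case: (eqVneq l i) => [->|_]; first by rewrite (negPf ij) (negPf ik) /= ?addbT ?addbF.
  case: (eqVneq l j) => [->|_]; first by rewrite (negPf jk) /= ?addbT ?addbF.
  by case: (eqVneq l k) => [->|_]; rewrite /= ?addbT ?addbF.
rewrite /vertex20 E1 E2 E3 {1}E0 big_mkcond sum8 !big_bool /weight3 /get3 /=.
case: (s i); case: (s j); case: (s k); rewrite /= ?eqxx /=.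
all: by ring.
Qed.

Section Runs.
Variable n : nat.
Implicit Types (s o : state (line n)) (c : site) (cs : seq site) (b : bits).

Definition hline_of c : line n := hl n c.2.
Definition dline_of c : line n := dl n (c.1 + c.2).
Definition vline_of c : line n := vl n c.1.

Definition set_bits s c b := set3 (hline_of c) (dline_of c) (vline_of c) s b.
Definition get_bits s c := get3 (hline_of c) (dline_of c) (vline_of c) s.

Fixpoint run_ok o s cs (t : seq bits) : bool :=
  match cs, t with
  | [::], [::] => s == o
  | c :: cs', b :: t' => (weight3 (get_bits s c) == weight3 b) && run_ok o (set_bits s c b) cs' t'
  | _, _ => false
  end.

Fixpoint runs o s cs : seq (seq bits) :=
  if cs is c :: cs' then
    [seq b :: t | b <- [seq b <- index_enum bits | weight3 (get_bits s c) == weight3 b],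
                  t <- runs o (set_bits s c b) cs']
  else if s == o then [:: [::]] else [::].

Lemma mem_runs o s cs t : (t \in runs o s cs) = run_ok o s cs t.
Proof.
elim: cs s t => [|c cs IHcs] s t /=; first by case: eqP; case: t.
apply/allpairsPdep/idP => [[b [t' [bc tc ->]]]|].
  by move: bc tc; rewrite mem_filter /= => /andP[-> _]; rewrite IHcs.
case: t => // b t /andP[wb ok]; exists b, t; split=> //; last by rewrite IHcs.
by rewrite mem_filter wb mem_index_enum.
Qed.

Lemma uniq_runs o s cs : uniq (runs o s cs).
Proof.
elim: cs s => [|c cs IHcs] s /=; first by case: eqP.
apply: allpairs_uniq_dep => [|b _|[b t] [b' t'] _ _ /= [-> ->]] //.
by rewrite filter_uniq // index_enum_uniq.
Qed.

(** All weights being 1, expanding the product vertex by vertex leaves one term for each run. *)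
Lemma size_runs (R : comPzRingType) o s cs :
  (\big[@after _/id]_(c <- cs) (@cell20 n R c.1 c.2)) (delta R o) s = (size (runs o s cs))%:R.
Proof.
elim: cs s => [|c cs IHcs] s /=.
  by rewrite big_nil /delta; case: eqP.
rewrite big_cons /after /cell20 vertex20_sum // size_allpairs_dep.
rewrite sumnE big_map natr_sum big_filter; apply: eq_bigr => b _.
by rewrite IHcs.
Qed.
End Runs.

(** * Times and states along the sweep *)

Local Open Scope nat_scope.

(** Times are of the form [q * n + r]; this reduces their comparison to linear conditions on columns
    and rows. *)
Lemma lex_ltn n q r q' r' : r < n -> r' < n ->
  (q * n + r < q' * n + r') = (q < q') || ((q == q') && (r < r')).
Proof.
move=> rn rn'; case: (ltngtP q q') => [qq|qq|->] /=; last by rewrite ltn_add2l.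
  have : q.+1 * n <= q' * n by rewrite leq_mul2r qq orbT.
  by rewrite mulSn; lia.
have : q'.+1 * n <= q * n by rewrite leq_mul2r qq orbT.
by rewrite mulSn; lia.
Qed.

Lemma lex_ltn0 n q r q' : r < n -> (q * n + r < q' * n) = (q < q').
Proof. by move=> rn; rewrite -[q' * n]addn0 lex_ltn ?ltn0 ?andbF ?orbF //; lia. Qed.

Section RunStates.
Variables (n m : nat) (phi : site -> bits).

(** The [k]-th vertex in the sweep of the columns from left to right, each
    from top to bottom. *)
Definition cell_at (k : nat) : site := ((k %/ n).+1, n - k %% n).
Definition time (c : site) : nat := c.1.-1 * n + (n - c.2).
Definition in_grid (c : site) : bool := (0 < c.1 <= n) && (0 < c.2 <= n).

Lemma cell_at_time c : in_grid c -> cell_at (time c) = c.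
Proof.
case: c => x y /andP[/andP[/= x0 xn] /andP[/= y0 yn]]; rewrite /cell_at /time /=.
have lt : n - y < n by lia.
by rewrite divnMDl ?divn_small ?modnMDl ?modn_small ?addn0 ?prednK ?subKn //; lia.
Qed.

Lemma time_lt c : in_grid c -> time c < n * n.
Proof. by case: c => x y; rewrite /in_grid /time /= => h; rewrite lex_ltn0; lia. Qed.

Lemma cell_at_grid k : k < n * n -> in_grid (cell_at k).
Proof.
move=> kn; have n0 : 0 < n by lia.
by rewrite /in_grid /cell_at /= ltn_divLR // kn /= leq_subr subn_gt0 ltn_mod n0.
Qed.

Lemma time_cell_at k : k < n * n -> time (cell_at k) = k.
Proof.
move=> kn; have n0 : 0 < n by lia.
by rewrite /time /cell_at /= subKn; [rewrite -divn_eq | rewrite ltnW // ltn_mod].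
Qed.

Fixpoint run_state (s : state (line n)) (k : nat) : state (line n) :=
  if k is k'.+1 then set_bits (run_state s k') (cell_at k') (phi (cell_at k')) else s.

Lemma run_ok_mkseq o s k0 k : 
  run_ok o (run_state s k0) [seq cell_at i | i <- iota k0 k] [seq phi (cell_at i) | i <- iota k0 k] <->
  (forall i, k0 <= i < k0 + k ->
     weight3 (get_bits (run_state s i) (cell_at i)) = weight3 (phi (cell_at i))) /\
  run_state s (k0 + k) = o.
Proof.
elim: k k0 => [|k IHk] k0 /=.
  by rewrite addn0; split=> [/eqP so|[_ ->]]; [split=> // i; lia|].
rewrite -[set_bits _ _ _]/(run_state s k0.+1); split=> [/andP[/eqP w /IHk[ws e]]|[ws e]].
  rewrite addnS -addSn; split=> // i ik; case: (eqVneq i k0) => [->|ik0] //.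
  by apply: ws; lia.
apply/andP; split; first by apply/eqP; apply: ws; lia.
by apply/IHk; rewrite addSnnS; split=> // i ik; apply: ws; lia.
Qed.

Lemma run_state_const s (l : line n) k1 k2 : k1 <= k2 ->
  (forall k, k1 <= k < k2 -> [&& l != hline_of n (cell_at k), l != dline_of n (cell_at k) & l != vline_of n (cell_at k)]) ->
  run_state s k2 l = run_state s k1 l.
Proof.
move=> /subnKC <-; elim: (k2 - k1) => [|d IHd] nl; first by rewrite addn0.
rewrite addnS /= ffunE.
have /and3P[/negPf-> /negPf-> /negPf->] : [&& l != hline_of n (cell_at (k1 + d)),
    l != dline_of n (cell_at (k1 + d)) & l != vline_of n (cell_at (k1 + d))] by apply: nl; lia.
by apply: IHd => k kk; apply: nl; lia.
Qed.

Lemma run_state_h s y k1 k2 : k1 <= k2 <= n * n -> 0 < y <= n ->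
  (forall k, k1 <= k < k2 -> (cell_at k).2 != y) ->
  run_state s k2 (hl n y) = run_state s k1 (hl n y).
Proof.
move=> kk yn ne; apply: run_state_const => [|k kk']; first by lia.
have cn : (cell_at k).2 <= n by rewrite leq_subr.
by rewrite /hline_of hl_eq //; [rewrite eq_sym ne|lia].
Qed.

Lemma run_state_v s x k1 k2 : k1 <= k2 <= n * n -> 0 < x <= n ->
  (forall k, k1 <= k < k2 -> (cell_at k).1 != x) ->
  run_state s k2 (vl n x) = run_state s k1 (vl n x).
Proof.
move=> kk yn ne; apply: run_state_const => [|k kk']; first by lia.
have /andP[/andP[_ xn] _] : in_grid (cell_at k) by apply: cell_at_grid; lia.
by rewrite /vline_of vl_eq //=; [rewrite eq_sym ne|lia].
Qed.

Lemma run_state_d s d k1 k2 : k1 <= k2 <= n * n -> d <= n + n ->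
  (forall k, k1 <= k < k2 -> (cell_at k).1 + (cell_at k).2 != d) ->
  run_state s k2 (dl n d) = run_state s k1 (dl n d).
Proof.
move=> kk dn ne; apply: run_state_const => [|k kk']; first by lia.
have /andP[/andP[_ xn] /andP[_ yn]] : in_grid (cell_at k) by apply: cell_at_grid; lia.
by rewrite /dline_of dl_eq //; [rewrite (eq_sym d) ne|lia].
Qed.

Lemma run_state_after s k l : run_state s k.+1 l =
  if l == hline_of n (cell_at k) then (phi (cell_at k)).1.1
  else if l == dline_of n (cell_at k) then (phi (cell_at k)).1.2
  else if l == vline_of n (cell_at k) then (phi (cell_at k)).2 else run_state s k l.
Proof. by rewrite /= ffunE. Qed.

Let cell_qr k : 0 < n -> exists q r, [/\ k = q * n + r, r < n & cell_at (q * n + r) = (q.+1, n - r)].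
Proof. by move=> n0; exists (k %/ n), (k %% n); rewrite -divn_eq ltn_mod. Qed.

Definition bits_in (c : site) : bits :=
  let: (x, y) := c in
  (if x == 1 then true else (phi (x.-1, y)).1.1,
   if (x == 1) || (y == n) then x + y <= m else (phi (x.-1, y.+1)).1.2,
   if y == n then false else (phi (x, y.+1)).2).

Lemma get_bits_run c : in_grid c -> get_bits (run_state (state_in n m) (time c)) c = bits_in c.
Proof.
case: c => x y cn; have /andP[/andP[/= x0 xn] /andP[/= y0 yn]] := cn.
have n0 : 0 < n by lia.
have tn := time_lt cn; rewrite /get_bits /get3 /bits_in; congr (_, _, _).
- rewrite /hline_of /=; case: eqP => x1.
    rewrite (@run_state_h _ _ 0) //; try lia; first by rewrite /= ffunE /= inordK ?y0 //; lia.
    by move=> k; have [q [r [-> rn ->]]] := cell_qr k n0; rewrite /time /= x1 ?lex_ltn; lia.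
  have cn' : in_grid (x.-1, y) by rewrite /in_grid /=; lia.
  have tt : time (x.-1, y) < time (x, y) by rewrite /time /= lex_ltn; lia.
  rewrite (@run_state_h _ _ (time (x.-1, y)).+1) //; try lia.
    by rewrite run_state_after cell_at_time // eqxx.
  by move=> k; have [q [r [-> rn ->]]] := cell_qr k n0; rewrite /time /= !lex_ltn; lia.
- rewrite /dline_of /=; case: ifP => xy.
    rewrite (@run_state_d _ _ 0) //; try lia; first by rewrite /= ffunE /= inordK //; lia.
    move=> k; have [q [r [-> rn ->]]] := cell_qr k n0; rewrite /time /= ?lex_ltn; try lia.
  have cn' : in_grid (x.-1, y.+1) by rewrite /in_grid /=; lia.
  have tt : time (x.-1, y.+1) < time (x, y) by rewrite /time /= lex_ltn; lia.
  rewrite (@run_state_d _ _ (time (x.-1, y.+1)).+1) //; try lia.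
    rewrite run_state_after cell_at_time // /dline_of /= (_ : x.-1 + y.+1 = x + y) ?eqxx //; lia.
  by move=> k; have [q [r [-> rn ->]]] := cell_qr k n0; rewrite /time /= !lex_ltn; lia.
- rewrite /vline_of /=; case: eqP => yn'.
    rewrite (@run_state_v _ _ 0) //; try lia; first by rewrite /= ffunE.
    by move=> k; have [q [r [-> rn ->]]] := cell_qr k n0; rewrite /time /= ?lex_ltn; lia.
  have cn' : in_grid (x, y.+1) by rewrite /in_grid /=; lia.
  have -> : time (x, y) = (time (x, y.+1)).+1 by rewrite /time /=; lia.
  by rewrite run_state_after cell_at_time // /vline_of eqxx.
Qed.

Definition bits_out_ok : Prop :=
  forall i, 0 < i <= n ->
    [/\ (phi (n, i)).1.1 = false, (phi (i, 1)).2 = true,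
        (phi (i, 1)).1.2 = (i.+1 <= m) & (phi (n, i)).1.2 = (n + i <= m)].

Lemma run_state_final : 0 < n -> run_state (state_in n m) (n * n) = state_out n m <-> bits_out_ok.
Proof.
move=> n0; set S := run_state _ _.
have Sh y : 0 < y <= n -> S (hl n y) = (phi (n, y)).1.1.
  move=> yn; have cn : in_grid (n, y) by rewrite /in_grid /=; lia.
  have tn := time_lt cn.
  rewrite /S (@run_state_h _ _ (time (n, y)).+1) //; try lia.
    by rewrite run_state_after cell_at_time // eqxx.
  by move=> k; have [q [r [-> rn ->]]] := cell_qr k n0; rewrite /time /= lex_ltn0 ?lex_ltn; lia.
have Sv x : 0 < x <= n -> S (vl n x) = (phi (x, 1)).2.
  move=> xn; have cn : in_grid (x, 1) by rewrite /in_grid /=; lia.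
  have tn := time_lt cn.
  rewrite /S (@run_state_v _ _ (time (x, 1)).+1) //; try lia.
    by rewrite run_state_after cell_at_time // /vline_of eqxx.
  by move=> k; have [q [r [-> rn ->]]] := cell_qr k n0; rewrite /time /= lex_ltn0 ?lex_ltn; lia.
have Sd1 x : 0 < x <= n -> S (dl n x.+1) = (phi (x, 1)).1.2.
  move=> xn; have cn : in_grid (x, 1) by rewrite /in_grid /=; lia.
  have tn := time_lt cn.
  rewrite /S (@run_state_d _ _ (time (x, 1)).+1) //; try lia.
    by rewrite run_state_after cell_at_time // /dline_of /= addn1 eqxx.
  by move=> k; have [q [r [-> rn ->]]] := cell_qr k n0; rewrite /time /= lex_ltn0 ?lex_ltn; lia.
have Sd2 y : 0 < y <= n -> S (dl n (n + y)) = (phi (n, y)).1.2.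
  move=> yn; have cn : in_grid (n, y) by rewrite /in_grid /=; lia.
  have tn := time_lt cn.
  rewrite /S (@run_state_d _ _ (time (n, y)).+1) //; try lia.
    by rewrite run_state_after cell_at_time // /dline_of /= eqxx.
  by move=> k; have [q [r [-> rn ->]]] := cell_qr k n0; rewrite /time /= lex_ltn0 ?lex_ltn; lia.
split=> [e i iN|ok].
  rewrite -Sh // -Sv // -Sd1 // -Sd2 // e !ffunE /= !inordK; try lia.
  by have /andP[-> _] := iN.
have Sconst l : (forall c, in_grid c -> [&& l != hline_of n c, l != dline_of n c & l != vline_of n c]) ->
    S l = state_in n m l.
  by move=> nl; apply: (@run_state_const _ _ 0) => // k kn; apply/nl/cell_at_grid.
apply/ffunP=> -[[i|i]|i]; rewrite [RHS]ffunE /=.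
- have iE : inl (inl i) = hl n i by rewrite /hl inord_val.
  have iN : i <= n by rewrite -ltnS.
  rewrite iE; case: (posnP i) => [i0|i0]; last by have [] := ok i (ltac:(by rewrite i0)); rewrite Sh ?i0.
  rewrite Sconst => [|c /andP[_ cn]]; first by rewrite ffunE /= inordK // i0.
  by rewrite /hline_of hl_eq //=; lia.
- have iE : inl (inr i) = vl n i by rewrite /vl inord_val.
  have iN : i <= n by rewrite -ltnS.
  rewrite iE; case: (posnP i) => [i0|i0]; last by have [] := ok i (ltac:(by rewrite i0)); rewrite Sv ?i0.
  rewrite Sconst => [|c /andP[cn _]]; first by rewrite ffunE.
  by rewrite /vline_of vl_eq //=; lia.
- have iE : inr i = dl n i by rewrite /dl inord_val.
  have iN : i <= n + n by rewrite -ltnS.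
  (* The diagonals 0 and 1 meet no vertex, since [x + y] is at least 2. *)
  rewrite iE; case: (leqP i 1) => [i1|i1].
    rewrite Sconst => [|c /andP[cn1 cn2]]; first by rewrite ffunE /= inordK.
    by rewrite /dline_of dl_eq //=; lia.
  (* A diagonal of index at most [n] leaves through the bottom row, any other one through the last
     column; index [n + 1] leaves at [(n, 1)], which lies on both. *)
  case: (leqP i n) => [im|mi].
    have [] := ok i.-1 _; first lia.
    by rewrite -Sd1 ?prednK //; lia.
  have [] := ok (i - n) _; first lia.
  by rewrite -(Sd2 (i - n)) ?subnKC //; lia.
Qed.

Lemma run_ok_cells : 0 < n ->
  run_ok (state_out n m) (state_in n m) [seq cell_at i | i <- iota 0 (n * n)]
     [seq phi (cell_at i) | i <- iota 0 (n * n)] <->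
  (forall c, in_grid c -> weight3 (bits_in c) = weight3 (phi c)) /\ bits_out_ok.
Proof.
move=> n0; rewrite -[X in run_ok _ X]/(run_state (state_in n m) 0).
apply: iff_trans (run_ok_mkseq _ _ _ _) _; rewrite add0n.
have fin := run_state_final n0; split=> -[ws /fin ok]; split=> //.
  by move=> c cn; have := ws (time c); rewrite cell_at_time // get_bits_run // time_lt // => ->.
by move=> i iN; have cn := cell_at_grid iN; rewrite -ws // -get_bits_run // time_cell_at.
Qed.
End RunStates.

(** * Orientations as runs *)

Lemma sum_pick (a k b l : nat) (C : nat -> nat -> bool) (p q : nat) :
  a <= p < a + k -> b <= q < b + l ->
  \sum_(x <- iota a k) \sum_(y <- iota b l) (C x y && ((x, y) == (p, q))) = C p q.
Proof.
move=> pk ql; rewrite (bigD1_seq p) ?iota_uniq ?mem_iota //= (bigD1_seq q) ?iota_uniq ?mem_iota //=.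
rewrite eqxx andbT big1 => [|y /negPf yq]; last by rewrite xpair_eqE yq !andbF.
rewrite big1 ?addn0 // => x /negPf xp; rewrite big1 // => y _.
by rewrite xpair_eqE xp !andbF.
Qed.

(** Among the edges of one direction, exactly one has [v] at the chosen end when kept and exactly
    one when reversed; [(p, q)] and [(p', q')] locate them. *)
Lemma sum_pick2 (T : eqType) (a k b l : nat) (B : nat -> nat -> bool) (f g : nat -> nat -> T) (v : T)
    (p q p' q' : nat) :
  a <= p < a + k -> b <= q < b + l -> a <= p' < a + k -> b <= q' < b + l ->
  (forall x y, (f x y == v) = ((x, y) == (p, q))) ->
  (forall x y, (g x y == v) = ((x, y) == (p', q'))) ->
  \sum_(x <- iota a k) \sum_(y <- iota b l) ((if B x y then f x y else g x y) == v) =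
  B p q + ~~ B p' q'.
Proof.
move=> pk ql pk' ql' fv gv.
rewrite -(sum_pick B pk ql) -(sum_pick (fun x y => ~~ B x y) pk' ql') -big_split /=.
apply: eq_bigr => x _; rewrite -big_split /=; apply: eq_bigr => y _.
by rewrite -fv -gv; case: (B x y); rewrite ?addn0.
Qed.

Local Notation arc := Defs.arc.

Section Orientations.
Variables (n : nat) (b : dwbc).
Hypothesis n0 : 0 < n.

Definition last_low (b : dwbc) : nat := if b is DWBC1 then n.+1 else n.
Notation m := (last_low b).

Section Bits.
Variable o : orientation n.

(** A line carries a particle along an edge that is oriented rightwards
    (horizontal and diagonal lines) or downwards (vertical lines); [hbit x y],
    [dbit x y] and [vbit x y] are the bits just after the vertex [(x, y)] of the
    sweep from left to right and downwards. *)
Definition edge_bit (a : arc) : bool := if insub a is Some e then o e else false.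

Definition hbit x y := if x == 0 then true else if x == n then false else edge_bit ((x, y), (x.+1, y)).
Definition vbit x y := if y == n.+1 then false else if y == 1 then true else ~~ edge_bit ((x, y.-1), (x, y)).
Definition dbit x y :=
  if (0 < x < n) && (1 < y <= n) then edge_bit ((x, y), (x.+1, y.-1)) else x + y <= m.

Definition bits_of (c : site) : bits := (hbit c.1 c.2, dbit c.1 c.2, vbit c.1 c.2).

Lemma bits_in_of x y : in_grid n (x, y) ->
  bits_in n m bits_of (x, y) = (hbit x.-1 y, dbit x.-1 y.+1, vbit x y.+1).
Proof.
rewrite /in_grid /= => /andP[xn yn]; rewrite /bits_in /bits_of /=; congr (_, _, _).
- by case: eqP => [->|_].
- case: ifP => // xy; rewrite /dbit ifF; last by move: xy; lia.
  by congr (_ <= _); lia.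
- by case: eqP => [->|//]; rewrite /vbit eqxx.
Qed.

Lemma bits_out_of : bits_out_ok n m bits_of.
Proof.
move=> i iN; rewrite /bits_of /= /hbit /vbit /dbit.
by split; do ?[rewrite ifF; last lia]; rewrite ?eqxx ?addn1 //; lia.
Qed.

Lemma edge_bit_val (e : inner_edge n) : edge_bit (val e) = o e.
Proof. by rewrite /edge_bit valK. Qed.

Let harc x y : arc := if hbit x y then ((x, y), (x.+1, y)) else ((x.+1, y), (x, y)).
Let varc x y : arc := if vbit x y.+1 then ((x, y.+1), (x, y)) else ((x, y), (x, y.+1)).
Let darc x y : arc := if dbit x y.+1 then ((x, y.+1), (x.+1, y)) else ((x.+1, y), (x, y.+1)).

Lemma mem_inner_edges (a : arc) : (a \in inner_edges n) =
  let: ((x, y), (x', y')) := a in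
  [|| [&& 0 < x < n, 0 < y <= n, x' == x.+1 & y' == y],
      [&& 0 < x <= n, 0 < y < n, x' == x & y' == y.+1] |
      [&& 0 < x < n, 1 < y <= n, x' == x.+1 & y' == y.-1]].
Proof.
case: a => [[x y] [x' y']]; rewrite !mem_cat; congr [|| _, _ | _].
- apply/allpairsP/idP => [[[p q] /= [+ + [-> -> -> ->]]]|]; rewrite ?mem_iota; first by lia.
  by move=> h; exists (x, y); rewrite !mem_iota /=; split; try lia; congr (_, (_, _)); lia.
- apply/allpairsP/idP => [[[p q] /= [+ + [-> -> -> ->]]]|]; rewrite ?mem_iota; first by lia.
  by move=> h; exists (x, y); rewrite !mem_iota /=; split; try lia; congr (_, (_, _)); lia.
- apply/allpairsP/idP => [[[p q] /= [+ + [-> -> -> ->]]]|]; rewrite ?mem_iota; first by lia.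
  by move=> h; exists (x, y.-1); rewrite !mem_iota /=; split; try lia; congr ((_, _), (_, _)); lia.
Qed.

Lemma uniq_inner_edges : uniq (inner_edges n).
Proof.
rewrite /inner_edges !cat_uniq !allpairs_uniq ?iota_uniq //=; try by move=> [x y] [x' y'] _ _ /= [-> ->].
rewrite !andbT has_cat negb_or -!all_predC; apply/andP; split; [apply/andP; split|]; apply/allP=> a /allpairsP[[p q] /= [_ _ ->]];
  apply/negP=> /allpairsP[[p' q'] /= [_ _ []]]; lia.
Qed.

Lemma sum_inner_arcs (p : arc -> bool) :
  count p (inner_arcs o) =
  \sum_(a <- inner_edges n) p (if edge_bit a then a else (a.2, a.1)).
Proof.
rewrite -sum1_count big_map big_mkcond big_enum /=.
rewrite -(big_seq_sub (fun a => p (if edge_bit a then a else (a.2, a.1)) : nat) uniq_inner_edges).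
by apply: eq_bigr => e _; rewrite edge_bit_val; case: (o e); case: (p _).
Qed.

Let iota1E : iota 1 n = rcons (iota 1 n.-1) n.
Proof. by rewrite -[in LHS](prednK n0) -[in LHS](addn1 n.-1) iotaD cats1 add1n prednK. Qed.

Let iotaE : iota 0 n.+1 = 0 :: rcons (iota 1 n.-1) n.
Proof. by rewrite -iota1E. Qed.

(** Inner, boundary and corner arcs together fill three rectangles of indices. The diagonal
    rectangle has two spurious corners, [darc 0 0] and [darc n n], which are not edges of the model;
    hence the hypotheses on [p]. *)
Lemma count_arcs (p : arc -> bool) : ~~ p (darc 0 0) -> ~~ p (darc n n) ->
  count p (arcs b o) =
  \sum_(x <- iota 0 n.+1) \sum_(y <- iota 1 n) p (harc x y) +
  \sum_(x <- iota 1 n) \sum_(y <- iota 0 n.+1) p (varc x y) +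
  \sum_(x <- iota 0 n.+1) \sum_(y <- iota 0 n.+1) p (darc x y).
Proof.
move=> p00 pnn; rewrite /arcs count_cat sum_inner_arcs.
have inn x : x \in iota 1 n.-1 -> [/\ x == 0 = false, x == n = false, 0 < x & x < n].
  by rewrite mem_iota => xn; split; lia.
have hE x y : x \in iota 1 n.-1 -> harc x y = if edge_bit ((x, y), (x.+1, y)) then ((x, y), (x.+1, y)) else ((x.+1, y), (x, y)).
  by case/inn=> e1 e2 _ _; rewrite /harc /hbit e1 e2.
have vE x y : y \in iota 1 n.-1 -> varc x y = if edge_bit ((x, y), (x, y.+1)) then ((x, y), (x, y.+1)) else ((x, y.+1), (x, y)).
  case/inn=> e1 e2 _ _; rewrite /varc /vbit !eqSS e1 e2 /=.
  by case: (edge_bit _).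
have dE x y : x \in iota 1 n.-1 -> y \in iota 1 n.-1 ->
    darc x y = if edge_bit ((x, y.+1), (x.+1, y)) then ((x, y.+1), (x.+1, y)) else ((x.+1, y), (x, y.+1)).
  case/inn=> _ _ e1 e2 /inn[_ _ e3 e4]; rewrite /darc /dbit.
  by have -> : (0 < x < n) && (1 < y.+1 <= n) by lia.
have h0 y : harc 0 y = ((0, y), (1, y)) by [].
have hn y : harc n y = ((n.+1, y), (n, y)) by rewrite /harc /hbit eqxx; case: eqP n0 => [->|].
have v0 x : varc x 0 = ((x, 1), (x, 0)) by rewrite /varc /vbit eqSS eq_sym -leqn0 leqNgt n0.
have vn x : varc x n = ((x, n), (x, n.+1)) by rewrite /varc /vbit eqxx.
have mn : n <= m <= n.+1 by case: b => /=; lia.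
have d0 y : y \in iota 1 n.-1 -> darc 0 y = ((0, y.+1), (1, y)).
  by case/inn=> _ _ e3 e4; rewrite /darc /dbit /= ifT //; lia.
have dn y : y \in iota 1 n.-1 -> darc n y = ((n.+1, y), (n, y.+1)).
  by case/inn=> _ _ e3 e4; rewrite /darc /dbit ltnn andbF /= ifF //; lia.
have dx0 x : x \in iota 1 n.-1 -> darc x 0 = ((x, 1), (x.+1, 0)).
  by case/inn=> _ _ e3 e4; rewrite /darc /dbit andbF /= ifT //; lia.
have dxn x : x \in iota 1 n.-1 -> darc x n = ((x.+1, n), (x, n.+1)).
  by case/inn=> _ _ e3 e4; rewrite /darc /dbit ltnn !andbF /= ifF //; lia.
have cE (T : Type) (f : T -> arc) (l : seq T) : count p [seq f x | x <- l] = \sum_(x <- l) p (f x).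
  by rewrite count_map -sum1_count big_mkcond; apply: eq_bigr => x _ /=; case: (p _).
have split3 (F : nat -> nat) : \sum_(x <- iota 0 n.+1) F x = F 0 + \sum_(x <- iota 1 n.-1) F x + F n.
  by rewrite iotaE big_cons -cats1 big_cat big_seq1 addnA.
have -> : \sum_(x <- iota 0 n.+1) \sum_(y <- iota 1 n) p (harc x y) =
    \sum_(x <- iota 1 n) p (0, x, (1, x)) + \sum_(i1 <- iota 1 n.-1) \sum_(i2 <- iota 1 n)
      p (if edge_bit (i1, i2, (i1.+1, i2)) then (i1, i2, (i1.+1, i2)) else (i1.+1, i2, (i1, i2))) +
    \sum_(x <- iota 1 n) p (n.+1, x, (n, x)).
  rewrite split3; congr (_ + _ + _); last by apply: eq_bigr => y _; rewrite hn.
  by apply: eq_big_seq => x xn; apply: eq_bigr => y _; rewrite hE.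
have -> : \sum_(x <- iota 1 n) \sum_(y <- iota 0 n.+1) p (varc x y) =
    \sum_(x <- iota 1 n) p (x, 1, (x, 0)) + \sum_(i1 <- iota 1 n) \sum_(i2 <- iota 1 n.-1)
      p (if edge_bit (i1, i2, (i1, i2.+1)) then (i1, i2, (i1, i2.+1)) else (i1, i2.+1, (i1, i2))) +
    \sum_(x <- iota 1 n) p (x, n, (x, n.+1)).
  rewrite -!big_split; apply: eq_bigr => x _ /=; rewrite split3 v0 vn; congr (_ + _ + _).
  by apply: eq_big_seq => y yn; rewrite vE.
have -> : \sum_(x <- iota 0 n.+1) \sum_(y <- iota 0 n.+1) p (darc x y) =
    \sum_(x <- iota 1 n.-1) p (0, x.+1, (1, x)) + p (darc 0 n) +
    (\sum_(x <- iota 1 n.-1) p (x, 1, (x.+1, 0)) + \sum_(i1 <- iota 1 n.-1) \sum_(i2 <- iota 1 n.-1)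
      p (if edge_bit (i1, i2.+1, (i1.+1, i2)) then (i1, i2.+1, (i1.+1, i2)) else (i1.+1, i2, (i1, i2.+1))) +
     \sum_(x <- iota 1 n.-1) p (x.+1, n, (x, n.+1))) +
    (p (darc n 0) + \sum_(x <- iota 1 n.-1) p (n.+1, x, (n, x.+1))).
  rewrite split3 !split3 (negPf p00) (negPf pnn) add0n addn0; congr (_ + _ + _ + (_ + _)).
  - by apply: eq_big_seq => y yn; rewrite d0.
  - rewrite -!big_split; apply: eq_big_seq => x xn /=; rewrite split3 dx0 // dxn //; congr (_ + _ + _).
    by apply: eq_big_seq => y yn; rewrite dE.
  - by apply: eq_big_seq => y yn; rewrite dn.
rewrite /boundary_arcs !count_cat !cE /inner_edges !big_cat !big_allpairs_dep /=.
have -> : count p (corner_arcs n b) = p (darc 0 n) + p (darc n 0).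
  have e1 : dbit 0 n.+1 = (n < m) by rewrite /dbit /= add0n.
  have e2 : dbit n 1 = (n < m) by rewrite /dbit ltnn andbF /= addn1.
  by rewrite /darc e1 e2; case: b; rewrite /= ?ltnSn ?ltnn addn0.
ring.
Qed.

Lemma count_tail x y : 0 < x <= n -> 0 < y <= n ->
  count (fun a : arc => a.2 == (x, y)) (arcs b o) =
  hbit x.-1 y + ~~ hbit x y + (vbit x y.+1 + ~~ vbit x y) + (dbit x.-1 y.+1 + ~~ dbit x y).
Proof.
move=> xn yn; rewrite count_arcs; first last.
- by rewrite /darc; case: ifP => _ /=; rewrite xpair_eqE; lia.
- by rewrite /darc; case: ifP => _ /=; rewrite xpair_eqE; lia.
congr (_ + _ + _).
- under eq_bigr => i _ do under eq_bigr => j _ do rewrite /harc (fun_if snd) /=.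
  by apply: sum_pick2; try lia; move=> i j; rewrite !xpair_eqE; lia.
- under eq_bigr => i _ do under eq_bigr => j _ do rewrite /varc (fun_if snd) /=.
  rewrite (@sum_pick2 _ _ _ _ _ (fun i j => vbit i j.+1) _ _ _ x y x y.-1); try lia;
    try by move=> i j; rewrite !xpair_eqE; lia.
  by rewrite prednK //; lia.
- under eq_bigr => i _ do under eq_bigr => j _ do rewrite /darc (fun_if snd) /=.
  rewrite (@sum_pick2 _ _ _ _ _ (fun i j => dbit i j.+1) _ _ _ x.-1 y x y.-1); try lia;
    try by move=> i j; rewrite !xpair_eqE; lia.
  by rewrite prednK //; lia.
Qed.

Lemma count_head x y : 0 < x <= n -> 0 < y <= n ->
  count (fun a : arc => a.1 == (x, y)) (arcs b o) =
  hbit x y + ~~ hbit x.-1 y + (vbit x y + ~~ vbit x y.+1) + (dbit x y + ~~ dbit x.-1 y.+1).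
Proof.
move=> xn yn; rewrite count_arcs; first last.
- by rewrite /darc; case: ifP => _ /=; rewrite xpair_eqE; lia.
- by rewrite /darc; case: ifP => _ /=; rewrite xpair_eqE; lia.
congr (_ + _ + _).
- under eq_bigr => i _ do under eq_bigr => j _ do rewrite /harc (fun_if fst) /=.
  by apply: sum_pick2; try lia; move=> i j; rewrite !xpair_eqE; lia.
- under eq_bigr => i _ do under eq_bigr => j _ do rewrite /varc (fun_if fst) /=.
  rewrite (@sum_pick2 _ _ _ _ _ (fun i j => vbit i j.+1) _ _ _ x y.-1 x y); try lia;
    try by move=> i j; rewrite !xpair_eqE; lia.
  by rewrite prednK //; lia.
- under eq_bigr => i _ do under eq_bigr => j _ do rewrite /darc (fun_if fst) /=.
  rewrite (@sum_pick2 _ _ _ _ _ (fun i j => dbit i j.+1) _ _ _ x y.-1 x.-1 y); try lia;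
    try by move=> i j; rewrite !xpair_eqE; lia.
  by rewrite prednK //; lia.
Qed.

(** With [i] particles before a vertex and [o] after it, there are [3 + i - o] incoming and
    [3 - i + o] outgoing edges, so the ice rule is particle conservation. *)
Lemma ice_rule_bits : ice_rule b o <->
  forall c, in_grid n c -> weight3 (bits_in n m bits_of c) = weight3 (bits_of c).
Proof.
have gridE c : (c \in Defs.grid n) = in_grid n c.
  case: c => x y; rewrite /in_grid /=; apply/allpairsP/idP => [[[p q] /= [+ + [-> ->]]]|xy].
    by rewrite !mem_iota; lia.
  by exists (x, y); rewrite !mem_iota; split=> //=; lia.
split=> [/allP ice [x y] xy|ice].
  have := ice (x, y); rewrite gridE => /(_ xy); have /andP[xn yn] := xy.
  rewrite bits_in_of // count_tail // count_head // /bits_of /weight3 /=.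
  case: hbit; case: hbit; case: vbit; case: vbit; case: dbit; case: dbit => //=.
apply/allP => -[x y]; rewrite gridE => xy; have := ice _ xy; have /andP[xn yn] := xy.
rewrite bits_in_of // count_tail // count_head // /bits_of /weight3 /=.
case: hbit; case: hbit; case: vbit; case: vbit; case: dbit; case: dbit => //=.
Qed.
End Bits.
End Orientations.

(** * The bijection between configurations and runs *)

Section CountRuns.
Variables (n : nat) (b : dwbc).
Hypothesis n0 : 0 < n.
Notation m := (last_low n b).

Definition cells : seq site := [seq cell_at n i | i <- iota 0 (n * n)].

(** Reads an orientation off the end point that the sweep meets first. Vertical edges are listed
    upwards but swept downwards, hence the negation and the use of [a.2]. *)
Definition arc_bit (phi : site -> bits) (a : arc) : bool :=
  if a.1.2 == a.2.2 then (phi a.1).1.1 else if a.1.1 == a.2.1 then ~~ (phi a.2).2 else (phi a.1).1.2.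

Lemma eq_arc_bit (phi psi : site -> bits) a :
  {in in_grid n, phi =1 psi} -> a \in inner_edges n -> arc_bit phi a = arc_bit psi a.
Proof.
case: a => [[x y] [x' y']] e; rewrite (mem_inner_edges n0) /arc_bit /= => h.
by rewrite !e //; rewrite /in_mem /= /in_grid /=; lia.
Qed.

Lemma arc_bit_of (o : orientation n) a : a \in inner_edges n -> arc_bit (bits_of b o) a = edge_bit o a.
Proof.
case: a => [[x y] [x' y']]; rewrite (mem_inner_edges n0) /arc_bit /= /hbit /vbit /dbit.
case/or3P=> /and4P[xn yn /eqP-> /eqP->].
- by rewrite eqxx !ifF //; lia.
- by rewrite eqxx !ifF ?negbK //; lia.
- by rewrite !(@ifF _ (_ == _)) ?xn ?yn //; lia.
Qed.

Lemma bits_of_arc_bit (phi : site -> bits) (o : orientation n) : bits_out_ok n m phi ->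
  (forall a, a \in inner_edges n -> edge_bit o a = arc_bit phi a) ->
  {in in_grid n, bits_of b o =1 phi}.
Proof.
move=> out oE [x y]; rewrite /in_mem /= /in_grid /= => /andP[xn yn].
have [hx _ _ dx] := out x xn; have [_ vx dx1 _] := out x xn; have [hy _ _ dy] := out y yn.
have -> : phi (x, y) = ((phi (x, y)).1.1, (phi (x, y)).1.2, (phi (x, y)).2) by case: (phi _) => [[]].
rewrite /bits_of /=; congr (_, _, _).
- rewrite /hbit ifF; last lia.
  case: eqP => [->|xn']; first by rewrite hy.
  by rewrite oE ?(mem_inner_edges n0) /arc_bit /= ?eqxx //; lia.
- rewrite /dbit; case: ifP => xy.
    by rewrite oE ?(mem_inner_edges n0) /arc_bit /= ?ifF //; lia.
  case: (eqVneq y 1) => [->|y1]; first by rewrite dx1 addn1.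
  by have -> : x = n by lia.
- rewrite /vbit ifF; last lia.
  case: eqP => [->|y1]; first by rewrite vx.
  by rewrite oE ?(mem_inner_edges n0) /arc_bit /= ?eqxx ?ifF ?negbK //; lia.
Qed.

(** An orientation is sent to the list of its bits in sweep order, and [arc_bit] inverts this map.
    For surjectivity, the bits of a run on boundary edges, which no orientation records, are forced
    by [bits_out_ok]. *)
Lemma num_20V_runs : num_20V n b = size (runs (state_out n m) (state_in n m) cells).
Proof.
pose G (phi : site -> bits) := [seq phi (cell_at n i) | i <- iota 0 (n * n)].
have G_eq phi psi : {in in_grid n, phi =1 psi} <-> G phi = G psi.
  split=> [e|/eq_in_map e c cn].
    by apply/eq_in_map => i; rewrite mem_iota => iN; apply/e/cell_at_grid.
  by rewrite -(cell_at_time cn); apply: e; rewrite mem_iota /= add0n; apply: time_lt.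
have iceE (o : orientation n) : ice_rule b o = (G (bits_of b o) \in runs (state_out n m) (state_in n m) cells).
  rewrite mem_runs; apply/idP/idP => [/(ice_rule_bits b n0) ice|].
    by apply/(run_ok_cells _ _ n0); split=> //; apply: bits_out_of.
  by move/(run_ok_cells _ _ n0) => [ice _]; apply/(ice_rule_bits b n0).
rewrite /num_20V cardE -(size_map (fun o => G (bits_of b o))); apply/perm_size/uniq_perm.
- rewrite map_inj_uniq ?enum_uniq // => o o' /G_eq e; apply/ffunP=> x.
  by rewrite -!edge_bit_val -!arc_bit_of ?(valP x) //; apply: eq_arc_bit (valP x).
- exact: uniq_runs.
move=> t; apply/mapP/idP => [[o]|tr]; first by rewrite mem_enum inE iceE => ice ->.
pose phi c := nth (false, false, false) t (time n c).
have st : size t = n * n.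
  move: tr; rewrite mem_runs -(size_iota 0 (n * n)) -(size_map (cell_at n)) -/cells.
  elim: cells (state_in n m) t {phi} => [|c cs IHcs] s [|x t] //= /andP[_ /IHcs].
  by rewrite /= => ->.
have tE : t = G phi.
  apply: (@eq_from_nth _ (false, false, false)) => [|i it]; rewrite ?size_map ?size_iota //.
  by rewrite (nth_map 0) ?size_iota -?st // nth_iota -?st // /phi time_cell_at // -st.
have [_ out] : (forall c, in_grid n c -> weight3 (bits_in n m phi c) = weight3 (phi c)) /\ bits_out_ok n m phi.
  by apply/(run_ok_cells _ _ n0); rewrite -mem_runs -/(G phi) -tE.
pose o : orientation n := [ffun e => arc_bit phi (val e)].
have oE a : a \in inner_edges n -> edge_bit o a = arc_bit phi a.
  by move=> an; rewrite /edge_bit insubT ffunE SubK.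
exists o; last by rewrite tE; apply/G_eq => c cn; rewrite (bits_of_arc_bit out oE).
rewrite mem_enum inE iceE (_ : G _ = t) // tE; apply/G_eq; exact: bits_of_arc_bit out oE.
Qed.
End CountRuns.

(** * Identification of the sweep with the operator words, and conclusion *)

Lemma cells_flatten n q : [seq cell_at n i | i <- iota 0 (q * n)] =
  [seq (x, y) | x <- iota 1 q, y <- rev (iota 1 n)].
Proof.
elim: q => [|q IHq] //; rewrite mulSn (addnC n) iotaD map_cat IHq add0n.
rewrite -[in RHS](addn1 q) iotaD allpairs_cat /= cats0 add1n.
congr (_ ++ _); have -> : iota (q * n) n = [seq q * n + i | i <- iota 0 n] by rewrite -iotaDl addn0.
rewrite -map_subn_iota (iotaDl 1 0 n) -!map_comp; apply/eq_in_map => i; rewrite mem_iota /= => iN.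
by rewrite /cell_at divnMDl ?divn_small ?modnMDl ?modn_small ?addn0 ?add1n ?subSS //; lia.
Qed.

Lemma word_cells (R : comPzRingType) n :
  word (@cell20 n R) = \big[@after _/id]_(c <- cells n) (@cell20 n R c.1 c.2).
Proof. by rewrite /cells cells_flatten big_allpairs_dep. Qed.

Lemma word_grid (R : comPzRingType) n (r : R) f :
  word (fun x y => lop (wsquare r) (hl n y) (vl n x)) f =
  grid (fun _ _ => wsquare r) (map (hl n) (rev (iota 1 n))) (map (vl n) (iota 1 n)) f.
Proof.
have afterE (F G : (state (line n) -> R) -> state (line n) -> R) g : after F G g = F (G g) by [].
rewrite /word; move: (rev (iota 1 n)) => H; elim: (iota 1 n) => [|x V IHV]; rewrite ?big_nil //= big_cons afterE IHV.
by move: (grid _ _ _ f) => g; elim: H {IHV} => [|y H IHH]; rewrite ?big_nil //= big_cons afterE IHH.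
Qed.

Lemma dwbc_state_in n m :
  dwbc_state (map (hl n) (rev (iota 1 n))) (map (vl n) (iota 1 n)) (state_in n m).
Proof.
split.
- rewrite cat_uniq !map_inj_in_uniq ?rev_uniq ?iota_uniq //=.
  + by rewrite andbT; apply/hasPn => l /mapP[x _ ->]; apply/mapP => -[].
  + by move=> x y; rewrite !mem_iota => xn yn /eqP; rewrite vl_eq; try lia; move/eqP.
  + by move=> x y; rewrite !mem_rev !mem_iota => xn yn /eqP; rewrite hl_eq; try lia; move/eqP.
- by move=> l /mapP[y]; rewrite mem_rev mem_iota => yn ->; rewrite ffunE /= inordK; lia.
- by move=> l /mapP[y _ ->]; rewrite ffunE.
Qed.

Lemma dwbc_flip_in n m :
  dwbc_flip (map (hl n) (rev (iota 1 n))) (map (vl n) (iota 1 n)) (state_in n m) = state_out n m.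
Proof.
apply/ffunP=> -[[i|i]|i]; rewrite !ffunE.
- case: ifP => // /negP iH; rewrite ifF; last by apply/mapP => -[].
  rewrite /=; apply/negP => i0; apply: iH; apply/mapP; exists (i : nat); last by rewrite /hl inord_val.
  by rewrite mem_rev mem_iota add1n i0 ltn_ord.
- rewrite ifF; last by apply/mapP => -[].
  case: ifP => [/mapP[x]|/negP iV] /=.
    by rewrite mem_iota => xn [->]; rewrite inordK; lia.
  rewrite /=; apply/esym/negP => i0; apply: iV; apply/mapP; exists (i : nat); last by rewrite /vl inord_val.
  by rewrite mem_iota add1n i0 ltn_ord.
- by do 2 (rewrite ifF; last by apply/mapP => -[]).
Qed.

Lemma num_20V_T4 (n : nat) (b : dwbc) : 0 < n -> num_20V n b = T4 n.
Proof.
(* [algC] supplies a square root of 2, and its characteristic 0 allows the equality of natural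
   numbers to be read back. *)
move=> n0; pose r : algC := sqrtC 2%:R.
have rr : (r * r = 2%:R)%R by rewrite -expr2 sqrtCK.
have rt : (r * r^-1 = 1)%R by rewrite divff // sqrtC_eq0 pnatr_eq0.
have mn : n <= last_low n b <= n.+1 by case: b => /=; lia.
apply/eqP; rewrite -(@eqr_nat algC) T4_det num_20V_runs // -size_runs -word_cells.
rewrite (word20_word6 rr rt mn) word_grid -(dwbc_flip_in n (last_low n b)); apply/eqP.
apply: (Z6_homogeneous rr _ _ (dwbc_state_in n _)); by rewrite size_map ?size_rev size_iota.
Qed.

Theorem theorem5p1 (n : nat) (hn : 1 <= n) :
  num_20V n DWBC1 = T4 n /\ num_20V n DWBC2 = T4 n.
Proof. by split; apply: num_20V_T4. Qed.
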